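(* For each finite cubic lattice $\Lambda\subset\mathbb{Z}^d$ (with periodic boundary conditions) let $\mathcal{L}^\Lambda$ be a Liouvillian, forming a sequence of strictly local, uniformly bounded Liouvillians that are reversible with respect to a sequence of states $\omega_\Lambda$ with density matrices $\rho_\Lambda$. Let $C_\Lambda$ (the charge) and $O^{(1)}_\Lambda,O^{(2)}_\Lambda$ (the order parameters) be self-adjoint extensive quantities with $$[C_\Lambda,O^{(1)}_\Lambda]=\mathrm{i}\,O^{(2)}_\Lambda,\qquad [C_\Lambda,O^{(2)}_\Lambda]=-\mathrm{i}\,O^{(1)}_\Lambda .$$ Assume that $[\rho_\Lambda,C_\Lambda]=0$ and that $$\omega_\Lambda\big((O^{(1)}_\Lambda)^2\big)=\omega_\Lambda\big((O^{(2)}_\Lambda)^2\big)\ \ge\ (\mu\, o\,|\Lambda|)^2$$ for all $\Lambda$, with a constant $0<\mu\le1$ independent of $\Lambda$. Then for any $M\in\mathbb{N}$ the states $\omega^{(M)}_\Lambda$ (defined in the context) are asymptotically reversible, i.e. $$\lim_{\Lambda\nearrow\mathbb{Z}^d}\big|\omega^{(M)}_\Lambda(\mathcal{L}^\Lambda[A]\,B)-\omega^{(M)}_\Lambda(A\,\mathcal{L}^\Lambda[B])\big|=0$$ for any two local operators $A,B$, and hence metastable, i.e. $\lim_{\Lambda\nearrow\mathbb{Z}^d}|\omega^{(M)}_\Lambda(\mathcal{L}^\Lambda[A])|=0$ for every local operator $A$.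
   Context: Setting: $\Lambda\subset\mathbb{Z}^d$ ranges over cubes of side length $L$ (volume $|\Lambda|=L^d$) with periodic boundary conditions; $\Lambda\nearrow\mathbb{Z}^d$ means $L\to\infty$ along cubes exhausting $\mathbb{Z}^d$. To each site $x$ a finite-dimensional Hilbert space $\mathcal{H}_x$ is attached (a regular lattice system, with fixed local dimension), and $\mathcal{H}_\Lambda=\bigotimes_{x\in\Lambda}\mathcal{H}_x$. A local operator is an operator with fixed finite support (independent of $\Lambda$), viewed as an operator on $\mathcal{H}_\Lambda$ for all large $\Lambda$. States: $\omega(A)=\mathrm{Tr}(\rho A)$. Liouvillians (Heisenberg picture): $\mathcal{L}^\Lambda=\sum_{x\in\Lambda}\mathcal{L}^\Lambda_x$ with $$\mathcal{L}^\Lambda_x[A]=\mathrm{i}[H_x,A]+\sum_i\Big(L_x^iA(L_x^i)^\dagger-\tfrac12\{L_x^i(L_x^i)^\dagger,A\}\Big).$$ Strictly local: there is a fixed $r$ (independent of $x,\Lambda$) such that all $H_x$ (self-adjoint) and $L^i_x$ are supported in the ball $B_r(x)$. Uniformly bounded: $\|\mathcal{L}^\Lambda_x[A]\|\le b\|A\|$ with $b>0$ independent of $x$ and $\Lambda$. Reversible: $\omega_\Lambda(A\,\mathcal{L}^\Lambda[B])=\omega_\Lambda(\mathcal{L}^\Lambda[A]\,B)$ for all operators $A,B$ on $\mathcal{H}_\Lambda$. Extensive quantity: an operator $X_\Lambda=\sum_{x\in\Lambda}X_{\{x\}}$ with each $X_{\{x\}}$ supported in a ball of fixed radius around $x$ and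 with norm bounded uniformly in $x$ and $\Lambda$. The constant $o$ is a uniform bound for the order parameters: $\|O^{(i)}_{\{x\}}\|\le o$. The states $\omega_\Lambda^{(M)}$: put $O^\pm_\Lambda:=O^{(1)}_\Lambda\pm\mathrm{i}\,O^{(2)}_\Lambda$, with the convention $(O^+_\Lambda)^{k}:=(O^-_\Lambda)^{-k}$ and $(O^-_\Lambda)^{k}:=(O^+_\Lambda)^{-k}$ for $k<0$. For integers $k,k'$ let $$\chi^{(k,k')}_\Lambda(A):=\frac{\omega_\Lambda\big((O^-_\Lambda)^{k'}A\,(O^+_\Lambda)^{k}\big)}{Z(k)Z(k')},\qquad Z(k):=\omega_\Lambda\big((O^-_\Lambda)^{k}(O^+_\Lambda)^{k}\big)^{1/2},$$ and $$\omega^{(M)}_\Lambda(A):=\frac{1}{2M+1}\sum_{k=-M}^{M}\sum_{k'=-M}^{M}\chi^{(k,k')}_\Lambda(A),$$ considered for $\Lambda$ large enough (depending on $M$) that the $Z(k)$, $|k|\le M$, are nonzero, and $M<|\Lambda|$. *)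

(* Defs.v *)
From mathcomp Require Import all_boot all_order all_algebra.
From mathcomp Require Import finmap complex.
From mathcomp Require Import classical_sets reals topology normedtype.

Set Implicit Arguments.
Unset Strict Implicit.
Unset Printing Implicit Defensive.

Import Order.TTheory GRing.Theory Num.Theory.
Import numFieldNormedType.Exports.

Local Open Scope classical_set_scope.
Local Open Scope ring_scope.
Local Open Scope sesquilinear_scope.
Local Open Scope complex_scope.

(* Operators on the tensor product of copies of C^q indexed by T, as matrices
   in the product basis: the basis vectors are the configurations T -> 'I_q,
   numbered by [enum_rank]. *)
Definition op (R : realType) (q : nat) (T : finType) : Type :=
  'M[R[i]]_#|{ffun T -> 'I_q}|.

(* For injective f : S -> T this is a |-> a (x) 1, with a acting on the tensor
   factors f(S) and the identity acting on all others.  The value carries no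
   meaning when f is not injective. *)
Definition embed (R : realType) (q : nat) (S T : finType) (f : S -> T)
    (a : op R q S) : op R q T :=
  \matrix_(i, j)
    let s : {ffun T -> 'I_q} := enum_val i in
    let t : {ffun T -> 'I_q} := enum_val j in
    if [forall y, (y \notin codom f) ==> (s y == t y)]
    then a (enum_rank [ffun x => s (f x)]) (enum_rank [ffun x => t (f x)])
    else 0.

Definition supported (R : realType) (q : nat) (T : finType) (S : {set T})
    (A : op R q T) : Prop :=
  exists a : op R q {x : T | x \in S}, A = embed val a.

Definition commutator (R : realType) (n : nat) (A B : 'M[R[i]]_n) : 'M[R[i]]_n :=
  A *m B - B *m A.

Definition anticommutator (R : realType) (n : nat) (A B : 'M[R[i]]_n)
    : 'M[R[i]]_n :=
  A *m B + B *m A.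

Definition l2norm (R : realType) (n : nat) (v : 'cV[R[i]]_n) : R :=
  Num.sqrt (\sum_i (Normc.normc (v i 0)) ^+ 2).

Definition opnorm (R : realType) (n : nat) (A : 'M[R[i]]_n) : R :=
  sup [set l2norm (A *m v) | v in [set v : 'cV[R[i]]_n | l2norm v <= 1]].

(* In R[i], 0 <= z includes that z is real, so the first clause also forces
   rho to be Hermitian. *)
Definition density_matrix (R : realType) (n : nat) (rho : 'M[R[i]]_n) : Prop :=
  (forall v : 'cV[R[i]]_n, 0 <= (v ^t* *m rho *m v) 0 0) /\ \tr rho = 1.

Definition state_of (R : realType) (n : nat) (rho A : 'M[R[i]]_n) : R[i] :=
  \tr (rho *m A).

(* One term of a Liouvillian, in the Heisenberg picture and with the convention
   that the adjoint stands on the right: H is its Hamiltonian part and Ls lists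
   its jump operators. *)
Definition lindblad_term (R : realType) (n : nat) (H : 'M[R[i]]_n)
    (Ls : seq 'M[R[i]]_n) (A : 'M[R[i]]_n) : 'M[R[i]]_n :=
  'i *: commutator H A
  + \sum_(K <- Ls)
      (K *m A *m K ^t* - 2^-1 *: anticommutator (K *m K ^t*) A).

Definition liouvillian (R : realType) (n : nat) (T : finType)
    (H : T -> 'M[R[i]]_n) (Ls : T -> seq 'M[R[i]]_n) (A : 'M[R[i]]_n)
    : 'M[R[i]]_n :=
  \sum_x lindblad_term (H x) (Ls x) A.

Definition reversible (R : realType) (n : nat) (rho : 'M[R[i]]_n)
    (Lv : 'M[R[i]]_n -> 'M[R[i]]_n) : Prop :=
  forall A B, state_of rho (A *m Lv B) = state_of rho (Lv A *m B).

(* The periodic cube with side length L.+1.  A cube of this side length in Z^d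
   placed anywhere is identified with it by reducing coordinates mod L.+1. *)
Definition torus (d L : nat) : finType := {ffun 'I_d -> 'I_L.+1}.

Definition torus_proj (d L : nat) (z : {ffun 'I_d -> int}) : torus d L :=
  [ffun k => inord `|(z k %% L.+1%:Z)%Z|%N].

(* Graph distance on the torus; i - j is subtraction mod L.+1. *)
Definition torus_dist (d L : nat) (x y : torus d L) : nat :=
  (\sum_k minn (x k - y k)%R (y k - x k)%R)%N.

Definition torus_ball (d L : nat) (r : nat) (x : torus d L) : {set torus d L} :=
  [set y | (torus_dist x y <= r)%N].

(* The local operator a, with finite support X in Z^d, on the cube of side
   L.+1.  The projection is injective on X for all large L. *)
Definition local_op (R : realType) (q d : nat) (X : {fset {ffun 'I_d -> int}})
    (a : op R q X) (L : nat) : op R q (torus d L) :=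
  embed (fun z : X => torus_proj L (val z)) a.

Definition strictly_local (R : realType) (q d : nat)
    (H : forall L, torus d L -> op R q (torus d L))
    (Ls : forall L, torus d L -> seq (op R q (torus d L))) : Prop :=
  exists r : nat, forall L (x : torus d L),
    supported (torus_ball r x) (H L x) /\
    (forall K, K \in Ls L x -> supported (torus_ball r x) K).

Definition uniformly_bounded (R : realType) (q d : nat)
    (H : forall L, torus d L -> op R q (torus d L))
    (Ls : forall L, torus d L -> seq (op R q (torus d L))) : Prop :=
  exists2 b : R, 0 < b & forall L (x : torus d L) (A : op R q (torus d L)),
    opnorm (lindblad_term (H L x) (Ls L x) A) <= b * opnorm A.

(* X is a sum of terms located at the sites, each of norm at most c. *)
Definition extensive (R : realType) (q d : nat) (c : R)
    (X : forall L, op R q (torus d L)) : Prop :=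
  exists (Xloc : forall L, torus d L -> op R q (torus d L)) (r : nat),
    (forall L, X L = \sum_x Xloc L x) /\
    (forall L (x : torus d L),
       supported (torus_ball r x) (Xloc L x) /\ opnorm (Xloc L x) <= c).

Definition signed_pow (R : realType) (n : nat) (P Q : 'M[R[i]]_n) (k : int)
    : 'M[R[i]]_n :=
  match k with
  | Posz m => P ^+ m
  | Negz m => Q ^+ m.+1
  end.

Definition Oplus (R : realType) (n : nat) (O1 O2 : 'M[R[i]]_n) : 'M[R[i]]_n :=
  O1 + 'i *: O2.

Definition Ominus (R : realType) (n : nat) (O1 O2 : 'M[R[i]]_n) : 'M[R[i]]_n :=
  O1 - 'i *: O2.

(* Negative powers of O+ are positive powers of O-, and conversely. *)
Definition Oplus_pow (R : realType) (n : nat) (O1 O2 : 'M[R[i]]_n) (k : int)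
    : 'M[R[i]]_n :=
  signed_pow (Oplus O1 O2) (Ominus O1 O2) k.

Definition Ominus_pow (R : realType) (n : nat) (O1 O2 : 'M[R[i]]_n) (k : int)
    : 'M[R[i]]_n :=
  signed_pow (Ominus O1 O2) (Oplus O1 O2) k.

Definition Znorm (R : realType) (n : nat) (rho O1 O2 : 'M[R[i]]_n) (k : int)
    : R[i] :=
  sqrtC (state_of rho (Ominus_pow O1 O2 k *m Oplus_pow O1 O2 k)).

Definition chi (R : realType) (n : nat) (rho O1 O2 : 'M[R[i]]_n) (k k' : int)
    (A : 'M[R[i]]_n) : R[i] :=
  state_of rho (Ominus_pow O1 O2 k' *m A *m Oplus_pow O1 O2 k)
  / (Znorm rho O1 O2 k * Znorm rho O1 O2 k').

(* The indices i and j run over 0, ..., 2M, hence i - M and j - M over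
   -M, ..., M. *)
Definition omegaM (R : realType) (n : nat) (rho O1 O2 : 'M[R[i]]_n) (M : nat)
    (A : 'M[R[i]]_n) : R[i] :=
  (M.*2.+1%:R)^-1 *
  \sum_(i < M.*2.+1) \sum_(j < M.*2.+1)
    chi rho O1 O2 (i%:Z - M%:Z) (j%:Z - M%:Z) A.

Definition asymptotically_reversible (R : realType) (q d : nat)
    (Lv : forall L, op R q (torus d L) -> op R q (torus d L))
    (w : forall L, op R q (torus d L) -> R[i]) : Prop :=
  forall (X Y : {fset {ffun 'I_d -> int}}) (a : op R q X) (b : op R q Y),
    (fun L => Normc.normc
       (w L (Lv L (local_op a L) *m local_op b L)
        - w L (local_op a L *m Lv L (local_op b L)))) @ \oo --> (0 : R).

Definition metastable (R : realType) (q d : nat)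
    (Lv : forall L, op R q (torus d L) -> op R q (torus d L))
    (w : forall L, op R q (torus d L) -> R[i]) : Prop :=
  forall (X : {fset {ffun 'I_d -> int}}) (a : op R q X),
    (fun L => Normc.normc (w L (Lv L (local_op a L)))) @ \oo --> (0 : R).

(* Main.v *)
(* Write V for the volume, nu = 1/V, Q = (O^+/V)^k, P = (O^-/V)^k', and Gamma_x for
   the carre du champ of the local term L_x.  Since L_x kills everything that
   commutes with its generators, L_x[Q] and Gamma_x(A, Q) only see the difference
   between Q and the same power with the O(1) many site terms near x removed, so
   both are O(nu).  Similarly L[Q] differs by O(nu) from an operator commuting with
   the generators at x, whence Gamma_x(L[Q], Q) = O(nu^2).  Reversibility gives
   omega(X L[Y]) = -1/2 sum_x omega(Gamma_x(X, Y)); therefore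
   omega(L[Q]^* L[Q]) = O(nu), although L[Q] is only O(1) in norm.
   Expanding omega(P A L[B Q]) = omega(L[P A] B Q) by the Leibniz rule, the
   difference omega(P L[A] B Q) - omega(P A L[B] Q) consists of Gamma terms
   localized near the supports of A and B, which are O(nu), and of
   omega(P A B L[Q]) and omega(L[P] A B Q), which are O(nu^(1/2)) by Cauchy-Schwarz.
   The normalizations stay away from zero: z_k = omega((O^-/V)^k (O^+/V)^k)
   satisfies z_k^2 <= z_(k-1) (z_(k+1) + O(nu)) because [O^+, O^-] = O(V), and
   long-range order bounds z_1 from below. *)

Require Import Defs.
From mathcomp Require Import all_boot all_order all_algebra.
From mathcomp Require Import finmap complex ring lra.
From mathcomp Require Import classical_sets reals topology normedtype interval_inference.

Set Implicit Arguments.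
Unset Strict Implicit.
Unset Printing Implicit Defensive.

Import Order.TTheory GRing.Theory Num.Theory.
Import numFieldNormedType.Exports.

Local Open Scope classical_set_scope.
Local Open Scope ring_scope.
Local Open Scope sesquilinear_scope.
Local Open Scope complex_scope.

Notation normc := Normc.normc.

(** * Real inequalities: squares and finite Cauchy-Schwarz *)

Lemma ler_sqrn (R : realDomainType) (x y : R) :
  0 <= y -> x ^+ 2 <= y ^+ 2 -> x <= y.
Proof.
move=> y0 h; case: (lerP 0 x) => [x0|/ltW x0]; last exact: le_trans x0 y0.
by rewrite -(@ler_pXn2r _ 2) // nnegrE.
Qed.

(** The quadratic form (u, v) |-> sum_i (u x_i + v y_i)^2 is nonnegative; its value at one suitable
    point gives the inequality. *)
Lemma cauchy_schwarz_sum (R : realFieldType) (I : finType) (x y : I -> R) :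
  (\sum_i x i * y i) ^+ 2 <= (\sum_i x i ^+ 2) * (\sum_i y i ^+ 2).
Proof.
set a := \sum_i x i ^+ 2; set b := \sum_i x i * y i; set c := \sum_i y i ^+ 2.
have q u v : 0 <= u ^+ 2 * a + 2 * u * v * b + v ^+ 2 * c.
  suff -> : u ^+ 2 * a + 2 * u * v * b + v ^+ 2 * c
            = \sum_i (u * x i + v * y i) ^+ 2.
    by apply: sumr_ge0 => i _; apply: sqr_ge0.
  rewrite !mulr_sumr -!big_split; apply: eq_bigr => i _ /=; ring.
have a0 : 0 <= a by apply: sumr_ge0 => i _; apply: sqr_ge0.
have c0 : 0 <= c by apply: sumr_ge0 => i _; apply: sqr_ge0.
have [a_eq0|an0] := eqVneq a 0.
  have h := q (- (c + 1)) b; rewrite a_eq0 in h *.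
  (* Here a = 0, and at this point the form has the value -b^2, so b = 0. *)
  by have := q (- (c + 1) / 2) b; rewrite a_eq0; have := sqr_ge0 b; nra.
have a_gt0 : 0 < a by rewrite lt0r an0.
(* At (-b, a) the form is a (a c - b^2), and a > 0 cancels. *)
have := q (- b) a; nra.
Qed.

Lemma weighted_cauchy_schwarz (R : rcfType) (I : finType) (w x : I -> R) :
  (forall i, 0 <= w i) ->
  (\sum_i w i * x i) ^+ 2 <= (\sum_i w i) * (\sum_i w i * x i ^+ 2).
Proof.
move=> w0.
have -> : \sum_i w i * x i
          = \sum_i Num.sqrt (w i) * (Num.sqrt (w i) * x i).
  by apply: eq_bigr => i _; rewrite mulrA -expr2 sqr_sqrtr.
apply: le_trans (cauchy_schwarz_sum _ _) _.
rewrite le_eqVlt; apply/orP; left; apply/eqP; congr (_ * _).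
  by apply: eq_bigr => i _; rewrite sqr_sqrtr.
by apply: eq_bigr => i _; rewrite exprMn sqr_sqrtr.
Qed.

(** * Norms *)

Section ComplexNorm.
Variable R : rcfType.
Implicit Types x y z : R[i].

Lemma normc_ge0 z : 0 <= normc z.
Proof. by case: z => a b; apply: sqrtr_ge0. Qed.

Lemma normcE z : (normc z)%:C = `|z|. Proof. by []. Qed.

Lemma normc_leD x y : normc (x + y) <= normc x + normc y.
Proof. exact: le_normcD. Qed.

Lemma normc_opp x : normc (- x) = normc x.
Proof. exact: normcN. Qed.

Lemma normc_leB x y : normc (x - y) <= normc x + normc y.
Proof. by rewrite -(normc_opp y); apply: normc_leD. Qed.

Lemma normc_conj z : normc (Num.conj z) = normc z.
Proof. by apply: (@complexI R); rewrite !normcE norm_conjC. Qed.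

Lemma normc_real (r : R) : 0 <= r -> normc r%:C = r.
Proof. by move=> r0; rewrite /= expr0n /= addr0 sqrtr_sqr ger0_norm. Qed.

Lemma normc_nat n : normc (n%:R : R[i]) = n%:R.
Proof.
have -> : (n%:R : R[i]) = (n%:R : R)%:C by rewrite rmorph_nat.
by rewrite normc_real ?ler0n.
Qed.

Lemma normcX z n : normc (z ^+ n) = normc z ^+ n.
Proof.
elim: n => [|n IH]; first by rewrite !expr0 Normc.normc1.
by rewrite !exprS Normc.normcM IH.
Qed.

Lemma normci : normc ('i%R : R[i]) = 1.
Proof.
by apply: (@complexI R); rewrite normcE normCi.
Qed.

Lemma normc_sum (I : Type) (r : seq I) (P : pred I) (F : I -> R[i]) :
  normc (\sum_(i <- r | P i) F i) <= \sum_(i <- r | P i) normc (F i).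
Proof.
elim/big_rec2: _ => [|i y x _ h]; first by rewrite Normc.normc0.
by apply: le_trans (normc_leD _ _) _; rewrite lerD2l.
Qed.

Lemma normc_sqr z : (normc z ^+ 2)%:C = Num.conj z * z.
Proof. by rewrite rmorphXn /= normcE normCKC. Qed.

(** The order of R[i] compares real parts; this turns a lower bound on the value of a state into one
    on its modulus. *)
Lemma normc_ge_real (r : R) z : r%:C <= z -> r <= normc z.
Proof.
rewrite lecE /= => /andP[_ h]; apply: le_trans h _.
case: z => a b /=; case: (lerP 0 a) => a0; last first.
  by apply: le_trans (ltW a0) (sqrtr_ge0 _).
by rewrite -{1}(ger0_norm a0) -sqrtr_sqr ler_wsqrtr // lerDl sqr_ge0.
Qed.

End ComplexNorm.

Section Norms.
Variable R : realType.

Lemma l2norm_ge0 n (v : 'cV[R[i]]_n) : 0 <= l2norm v.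
Proof. exact: sqrtr_ge0. Qed.

Lemma l2norm_sqr n (v : 'cV[R[i]]_n) :
  l2norm v ^+ 2 = \sum_i normc (v i 0) ^+ 2.
Proof. by rewrite sqr_sqrtr // sumr_ge0 // => i _; apply: sqr_ge0. Qed.

Lemma l2norm_inner n (u v : 'cV[R[i]]_n) :
  \sum_i normc (u i 0) * normc (v i 0) <= l2norm u * l2norm v.
Proof.
apply: ler_sqrn; first by rewrite mulr_ge0 ?l2norm_ge0.
by rewrite exprMn !l2norm_sqr cauchy_schwarz_sum.
Qed.

Lemma l2normD n (u v : 'cV[R[i]]_n) : l2norm (u + v) <= l2norm u + l2norm v.
Proof.
apply: ler_sqrn; first by rewrite addr_ge0 ?l2norm_ge0.
rewrite sqrrD !l2norm_sqr.
apply: (@le_trans _ _ (\sum_i (normc (u i 0) + normc (v i 0)) ^+ 2)).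
  apply: ler_sum => i _; rewrite mxE.
  by rewrite ler_pXn2r ?normc_leD // nnegrE ?addr_ge0 ?normc_ge0.
under eq_bigr do rewrite sqrrD.
rewrite !big_split /= lerD2r lerD2l mulr2n.
by apply: lerD; apply: l2norm_inner.
Qed.

Lemma l2normZ n (c : R[i]) (v : 'cV[R[i]]_n) :
  l2norm (c *: v) = normc c * l2norm v.
Proof.
apply/eqP; rewrite -(@eqrXn2 _ 2) ?mulr_ge0 ?l2norm_ge0 ?normc_ge0 //.
rewrite exprMn !l2norm_sqr mulr_sumr; apply/eqP; apply: eq_bigr => i _.
by rewrite mxE Normc.normcM exprMn.
Qed.

Lemma l2norm0 n : l2norm (0 : 'cV[R[i]]_n) = 0.
Proof. by rewrite -(scale0r (0 : 'cV[R[i]]_n)) l2normZ Normc.normc0 mul0r. Qed.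

Lemma l2norm_eq0 n (v : 'cV[R[i]]_n) : l2norm v = 0 -> v = 0.
Proof.
move=> h; apply/matrixP => i j; rewrite ord1 mxE; apply: Normc.eq0_normc.
have := l2norm_sqr v; rewrite h expr0n /= => /esym/eqP.
rewrite psumr_eq0 => [|k _]; last exact: sqr_ge0.
by move=> /allP/(_ i (mem_index_enum _))/=; rewrite sqrf_eq0 => /eqP.
Qed.

(** Schur test: in each row, Cauchy-Schwarz with the weights |A_ij| uses the row sums; summing over
    the rows then uses the column sums. *)
Lemma l2norm_schur n (A : 'M[R[i]]_n) (c : R) :
  (forall i, \sum_j normc (A i j) <= c) ->
  (forall j, \sum_i normc (A i j) <= c) ->
  forall v, l2norm (A *m v) <= c * l2norm v.
Proof.
move=> hr hc v.
(* In dimension 0 the hypotheses do not force c to be nonnegative. *)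
case: n A v hr hc => [|n] A v hr hc.
  by rewrite /l2norm !big_ord0 sqrtr0 mulr0.
have c0 : 0 <= c by apply: le_trans (hr 0); rewrite sumr_ge0 // => i _; exact: normc_ge0.
apply: ler_sqrn; first by rewrite mulr_ge0 ?l2norm_ge0.
rewrite exprMn !l2norm_sqr.
apply: (@le_trans _ _ (\sum_i c * \sum_j normc (A i j) * normc (v j 0) ^+ 2)).
  apply: ler_sum => i _; rewrite mxE.
  apply: (@le_trans _ _ ((\sum_j normc (A i j) * normc (v j 0)) ^+ 2)).
    have h : normc (\sum_j A i j * v j 0) <= \sum_j normc (A i j) * normc (v j 0).
      apply: le_trans (normc_sum _ _ _) _; apply: ler_sum => j _.
      by rewrite Normc.normcM.
    by apply: lerXn2r h; rewrite nnegrE ?normc_ge0 // sumr_ge0 // => j _;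
       rewrite mulr_ge0 ?normc_ge0.
  apply: le_trans (weighted_cauchy_schwarz _ _) _.
    by move=> j; apply: normc_ge0.
  apply: ler_wpM2r (hr i); apply: sumr_ge0 => j _.
  by rewrite mulr_ge0 ?sqr_ge0 ?normc_ge0.
rewrite -mulr_sumr exchange_big /= expr2 -mulrA ler_wpM2l // mulr_sumr.
apply: ler_sum => j _; rewrite -mulr_suml ler_wpM2r ?sqr_ge0 //.
Qed.

(** Shows that the set whose supremum is [opnorm] is bounded, without which the supremum would carry
    no information. *)
Lemma l2norm_bounded n (A : 'M[R[i]]_n) :
  exists2 c, 0 <= c & forall v, l2norm (A *m v) <= c * l2norm v.
Proof.
exists (\sum_i \sum_j normc (A i j)).
  by apply: sumr_ge0 => i _; apply: sumr_ge0 => j _; apply: normc_ge0.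
apply: l2norm_schur => [i|j].
  rewrite [leRHS](bigD1 i) //= lerDl.
  by apply: sumr_ge0 => k _; apply: sumr_ge0 => j _; apply: normc_ge0.
apply: ler_sum => i _; rewrite (bigD1 j) //= lerDl.
by apply: sumr_ge0 => k _; apply: normc_ge0.
Qed.

Lemma l2norm_opnorm n (A : 'M[R[i]]_n) v :
  l2norm (A *m v) <= opnorm A * l2norm v.
Proof.
have [v0|vn0] := eqVneq (l2norm v) 0.
  by rewrite v0 mulr0 (l2norm_eq0 v0) mulmx0 l2norm0.
have vgt0 : 0 < l2norm v by rewrite lt0r vn0 l2norm_ge0.
have normu : normc ((l2norm v)^-1%:C) = (l2norm v)^-1.
  by rewrite normc_real // invr_ge0 l2norm_ge0.
have h : l2norm (A *m ((l2norm v)^-1%:C *: v)) <= opnorm A.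
  apply: ub_le_sup.
    have [c c0 hc] := l2norm_bounded A; exists c => _ [u /= u1 <-].
    by apply: le_trans (hc u) _; apply: ler_piMr.
  exists ((l2norm v)^-1%:C *: v) => //=.
  by rewrite l2normZ normu mulVf.
move: h; rewrite -scalemxAr l2normZ normu => h.
by rewrite -ler_pdivrMr // mulrC.
Qed.

Lemma opnorm_le n (A : 'M[R[i]]_n) c :
  0 <= c -> (forall v, l2norm (A *m v) <= c * l2norm v) -> opnorm A <= c.
Proof.
move=> c0 h; apply: ge_sup.
  by exists (l2norm (A *m 0)); exists 0 => //=; rewrite l2norm0 ler01.
by move=> _ [v /= v1 <-]; apply: le_trans (h v) _; apply: ler_piMr.
Qed.

Lemma opnorm_ge0 n (A : 'M[R[i]]_n) : 0 <= opnorm A.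
Proof.
apply: le_trans (l2norm_ge0 (A *m 0)) _; apply: ub_le_sup.
  have [c c0 hc] := l2norm_bounded A; exists c => _ [u /= u1 <-].
  by apply: le_trans (hc u) _; apply: ler_piMr.
by exists 0 => //=; rewrite l2norm0 ler01.
Qed.

Lemma opnormD n (A B : 'M[R[i]]_n) : opnorm (A + B) <= opnorm A + opnorm B.
Proof.
apply: opnorm_le => [|v]; first by rewrite addr_ge0 ?opnorm_ge0.
rewrite mulmxDl mulrDl; apply: le_trans (l2normD _ _) _.
by rewrite lerD ?l2norm_opnorm.
Qed.

Lemma opnormM n (A B : 'M[R[i]]_n) : opnorm (A *m B) <= opnorm A * opnorm B.
Proof.
apply: opnorm_le => [|v]; first by rewrite mulr_ge0 ?opnorm_ge0.
rewrite -mulmxA; apply: le_trans (l2norm_opnorm _ _) _.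
by rewrite -mulrA ler_wpM2l ?opnorm_ge0 ?l2norm_opnorm.
Qed.

Lemma opnormZ_le n (c : R[i]) (A : 'M[R[i]]_n) :
  opnorm (c *: A) <= normc c * opnorm A.
Proof.
apply: opnorm_le => [|v]; first by rewrite mulr_ge0 ?opnorm_ge0 ?normc_ge0.
by rewrite -scalemxAl l2normZ -mulrA ler_wpM2l ?normc_ge0 ?l2norm_opnorm.
Qed.

Lemma opnormN n (A : 'M[R[i]]_n) : opnorm (- A) = opnorm A.
Proof.
have h (B : 'M[R[i]]_n) : opnorm (- B) <= opnorm B.
  rewrite -scaleN1r; apply: le_trans (opnormZ_le _ _) _.
  by rewrite normc_opp Normc.normc1 mul1r.
apply: le_anti; apply/andP; split; first exact: h.
by have := h (- A); rewrite opprK.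
Qed.

Lemma opnormB n (A B : 'M[R[i]]_n) : opnorm (A - B) <= opnorm A + opnorm B.
Proof. by rewrite -(opnormN B) opnormD. Qed.

Lemma opnorm0 n : opnorm (0 : 'M[R[i]]_n) = 0.
Proof.
apply/eqP; rewrite eq_le opnorm_ge0 andbT.
by apply: opnorm_le => // v; rewrite mul0mx l2norm0 mul0r.
Qed.

(** Only an inequality: in dimension 0 the identity has norm 0. *)
Lemma opnorm1 n : opnorm (1%:M : 'M[R[i]]_n) <= 1.
Proof. by apply: opnorm_le => // v; rewrite mul1mx mul1r. Qed.

Lemma opnorm_sum n (I : finType) (P : pred I) (F : I -> 'M[R[i]]_n) :
  opnorm (\sum_(i | P i) F i) <= \sum_(i | P i) opnorm (F i).
Proof.
elim/big_rec2: _ => [|i y x _ h]; first by rewrite opnorm0.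
by apply: le_trans (opnormD _ _) _; rewrite lerD2l.
Qed.

Lemma opnorm_sum_le n (I : finType) (P : pred I) (F : I -> 'M[R[i]]_n) c m :
  0 <= c -> (forall i, P i -> opnorm (F i) <= c) -> (#|P| <= m)%N ->
  opnorm (\sum_(i | P i) F i) <= m%:R * c.
Proof.
move=> c0 h hm; apply: le_trans (opnorm_sum _ _) _.
apply: (@le_trans _ _ (\sum_(i | P i) c)); first exact: ler_sum.
by rewrite sumr_const -[leLHS]mulr_natl ler_wpM2r // ler_nat.
Qed.

Lemma opnormM_le n (A B : 'M[R[i]]_n) a b :
  opnorm A <= a -> opnorm B <= b -> opnorm (A *m B) <= a * b.
Proof.
by move=> hA hB; apply: le_trans (opnormM _ _) _; rewrite ler_pM ?opnorm_ge0.
Qed.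

Lemma opnormX_le n (A : 'M[R[i]]_n) a k : opnorm A <= a -> opnorm (A ^+ k) <= a ^+ k.
Proof.
move=> hA; elim: k => [|k IH]; first by rewrite !expr0 opnorm1.
by rewrite !exprS; apply: opnormM_le.
Qed.

End Norms.

(** * Adjoints and states *)

Section Adjoint.
Variable C : numClosedFieldType.

Lemma adjmxD m n (A B : 'M[C]_(m, n)) : (A + B) ^t* = A ^t* + B ^t*.
Proof. by apply/matrixP => i j; rewrite !mxE rmorphD. Qed.

Lemma adjmxN m n (A : 'M[C]_(m, n)) : (- A) ^t* = - A ^t*.
Proof. by apply/matrixP => i j; rewrite !mxE rmorphN. Qed.

Lemma adjmxZ m n c (A : 'M[C]_(m, n)) : (c *: A) ^t* = Num.conj c *: A ^t*.
Proof. by apply/matrixP => i j; rewrite !mxE rmorphM. Qed.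

Lemma adjmxM m n p (A : 'M[C]_(m, n)) (B : 'M[C]_(n, p)) :
  (A *m B) ^t* = B ^t* *m A ^t*.
Proof.
apply/matrixP => i j; rewrite !mxE rmorph_sum; apply: eq_bigr => k _.
by rewrite !mxE rmorphM mulrC.
Qed.

Lemma adjmx1 n : (1%:M : 'M[C]_n) ^t* = 1%:M.
Proof. by apply/matrixP => i j; rewrite !mxE eq_sym rmorph_nat. Qed.

Lemma adjmx0 m n : (0 : 'M[C]_(m, n)) ^t* = 0.
Proof. by apply/matrixP => i j; rewrite !mxE rmorph0. Qed.

Lemma adjmx_sum m n (I : Type) (r : seq I) (P : pred I) (F : I -> 'M[C]_(m, n)) :
  (\sum_(i <- r | P i) F i) ^t* = \sum_(i <- r | P i) (F i) ^t*.
Proof.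
by elim/big_rec2: _ => [|i y x _ <-]; rewrite ?adjmx0 ?adjmxD.
Qed.

Lemma adjmxX n (A : 'M[C]_n) k : (A ^+ k) ^t* = (A ^t*) ^+ k.
Proof.
elim: k => [|k IH]; first by rewrite !expr0 adjmx1.
by rewrite exprS adjmxM IH exprSr.
Qed.

End Adjoint.

Section AdjointNorm.
Variable R : realType.

(** |A^* v|^2 = <v, A A^* v> is at most |v| |A| |A^* v|, and one factor |A^* v| cancels. *)
Lemma opnorm_adj n (A : 'M[R[i]]_n) : opnorm (A ^t*) <= opnorm A.
Proof.
apply: opnorm_le (opnorm_ge0 A) _ => v.
set u := A ^t* *m v.
have [u0|un0] := eqVneq (l2norm u) 0.
  by rewrite u0 mulr_ge0 ?opnorm_ge0 ?l2norm_ge0.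
have ugt0 : 0 < l2norm u by rewrite lt0r un0 l2norm_ge0.
have inner (x y : 'cV[R[i]]_n) :
    normc ((x ^t* *m y) 0 0) <= l2norm x * l2norm y.
  rewrite mxE; apply: le_trans (normc_sum _ _ _) _.
  apply: le_trans (l2norm_inner _ _); apply: ler_sum => i _.
  by rewrite Normc.normcM !mxE normc_conj.
have uu : l2norm u ^+ 2 = normc ((u ^t* *m u) 0 0).
  rewrite -[LHS]normc_real ?sqr_ge0 // l2norm_sqr mxE rmorph_sum.
  by congr normc; apply: eq_bigr => i _; rewrite !mxE -normc_sqr.
rewrite -(ler_pM2r ugt0) -expr2 uu {1}/u adjmxM trmxCK -mulmxA.
apply: le_trans (inner _ _) _.
by rewrite -mulrA [leRHS]mulrCA ler_wpM2l ?l2norm_ge0 ?l2norm_opnorm.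
Qed.

End AdjointNorm.

(** * Positivity of states *)

Section States.
Variable R : realType.

(** Polarization: positivity on e_i + c e_j makes c rho_ij + conj(c) rho_ji real; c = 1 and c = i
    then recover rho_ij as the conjugate of rho_ji. *)
Lemma psd_hermitian n (rho : 'M[R[i]]_n) :
  (forall v : 'cV[R[i]]_n, 0 <= (v ^t* *m rho *m v) 0 0) -> rho = rho ^t*.
Proof.
move=> psd; apply/matrixP => i j; rewrite !mxE.
pose f (u v : 'cV[R[i]]_n) := (u ^t* *m rho *m v) 0 0.
have fDl u u' v : f (u + u') v = f u v + f u' v.
  by rewrite /f adjmxD !mulmxDl mxE.
have fDr u v v' : f u (v + v') = f u v + f u v' by rewrite /f mulmxDr mxE.
have fZl c u v : f (c *: u) v = Num.conj c * f u v.
  by rewrite /f adjmxZ -!scalemxAl mxE.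
have fZr c u v : f u (c *: v) = c * f u v by rewrite /f -!scalemxAr mxE.
have fE k l : f (delta_mx k 0) (delta_mx l 0) = rho k l.
  by rewrite /f -map_trmx map_delta_mx trmx_delta -rowE -colE !mxE.
have {}psd v : 0 <= f v v by apply: psd.
have real c : c * rho i j + Num.conj c * rho j i \is Num.real.
  have := psd (delta_mx i 0 + c *: delta_mx j 0).
  have := psd (delta_mx i 0); have := psd (delta_mx j 0).
  rewrite fDl !fDr !fZl !fZr !fE => hj hi h.
  have -> : c * rho i j + Num.conj c * rho j i
          = rho i i + c * rho i j
             + (Num.conj c * rho j i + Num.conj c * (c * rho j j))
             - rho i i - (c * Num.conj c) * rho j j by ring.
  apply: rpredB; last by apply: ger0_real; rewrite mulr_ge0 // mul_conjC_ge0.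
  by apply: rpredB; apply: ger0_real.
have /CrealP e1 := real 1; have /CrealP e2 := real 'i%R.
rewrite !rmorphD !rmorphM /= !conjCK rmorph1 conjCi !mul1r in e1 e2.
move: e1 e2; move: (Num.conj (rho i j)) (Num.conj (rho j i)) => u v e1 e2.
have nz : 2 * 'i != 0 :> R[i] by rewrite mulf_neq0 ?neq0Ci ?pnatr_eq0.
apply: (mulfI nz).
have -> : 2 * 'i * rho i j
        = 'i * (rho i j + rho j i) + ('i * rho i j + - 'i * rho j i) by ring.
by rewrite -e1 -e2; ring.
Qed.

(** By the spectral theorem rho = P^* D P with P unitary and D >= 0; then s = D^(1/2) P. *)
Lemma psd_factor n (rho : 'M[R[i]]_n) :
  (forall v : 'cV[R[i]]_n, 0 <= (v ^t* *m rho *m v) 0 0) ->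
  exists s : 'M[R[i]]_n, rho = s ^t* *m s.
Proof.
move=> psd; have rhoH := psd_hermitian psd.
have /orthomx_spectralP : rho \is normalmx.
  by apply: hermitian_normalmx; apply/is_hermitianmxP; rewrite expr0 scale1r.
have U := spectral_unitarymx rho; rewrite invmx_unitary //.
move: (spectralmx rho) (spectral_diag rho) U => P dg U rhoE.
have PP : P *m P ^t* = 1%:M by apply/unitarymxP.
have d_ge0 k : 0 <= dg 0 k.
  have := psd (P ^t* *m delta_mx k 0).
  rewrite adjmxM trmxCK rhoE !mulmxA -(mulmxA _ P (P ^t*)) PP mulmx1.
  rewrite -(mulmxA _ P (P ^t*)) PP mulmx1 -map_trmx map_delta_mx trmx_delta.
  by rewrite -rowE -colE !mxE eqxx mulr1n.
pose e := \row_k sqrtC (dg 0 k); exists (diag_mx e *m P).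
have ee : (diag_mx e) ^t* *m diag_mx e = diag_mx dg.
  apply/matrixP => i j; rewrite mul_mx_diag !mxE.
  have [->|ne] := eqVneq j i.
    by rewrite ?eqxx !mulr1n geC0_conj ?sqrtC_ge0 // -expr2 sqrtCK.
  by rewrite !mulr0n conjC0 mul0r.
by rewrite adjmxM mulmxA -(mulmxA (P ^t*)) ee -rhoE.
Qed.

Section FixedState.
Variables (n : nat) (rho : 'M[R[i]]_n).
Hypothesis rho_dm : density_matrix rho.

Lemma stateD A B : state_of rho (A + B) = state_of rho A + state_of rho B.
Proof. by rewrite /state_of mulmxDr mxtraceD. Qed.

Lemma stateN A : state_of rho (- A) = - state_of rho A.
Proof. by rewrite /state_of mulmxN raddfN. Qed.

Lemma stateB A B : state_of rho (A - B) = state_of rho A - state_of rho B.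
Proof. by rewrite stateD stateN. Qed.

Lemma stateZ c A : state_of rho (c *: A) = c * state_of rho A.
Proof. by rewrite /state_of -scalemxAr mxtraceZ. Qed.

Lemma state1 : state_of rho 1%:M = 1.
Proof. by rewrite /state_of mulmx1; case: rho_dm. Qed.

(* A positive state is the Hilbert-Schmidt form (X, Y) |-> tr(X^* Y) twisted
   by a square root of the density matrix. *)
Lemma state_hilbert_schmidt : exists t : 'M[R[i]]_n, forall X Y : 'M[R[i]]_n,
  state_of rho (X ^t* *m Y)
  = \sum_j \sum_i Num.conj ((X *m t) i j) * (Y *m t) i j.
Proof.
have [s rhoE] := psd_factor rho_dm.1; exists (s ^t*) => X Y.
rewrite /state_of rhoE -mulmxA mxtrace_mulC.
have -> : s *m (X ^t* *m Y) *m s ^t* = (X *m s ^t*) ^t* *m (Y *m s ^t*).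
  by rewrite adjmxM trmxCK !mulmxA.
rewrite /mxtrace; apply: eq_bigr => j _; rewrite mxE; apply: eq_bigr => i _.
by rewrite !mxE.
Qed.

(** In the Hilbert-Schmidt form this is the finite inequality over pairs of matrix indices. *)
Lemma state_cauchy_schwarz (X Y : 'M[R[i]]_n) :
  normc (state_of rho (X ^t* *m Y)) ^+ 2
  <= normc (state_of rho (X ^t* *m X)) * normc (state_of rho (Y ^t* *m Y)).
Proof.
have [t tE] := state_hilbert_schmidt.
have diag (Z : 'M[R[i]]_n) : normc (state_of rho (Z ^t* *m Z))
              = \sum_j \sum_i normc ((Z *m t) i j) ^+ 2.
  rewrite tE -[RHS]normc_real; last first.
    by apply: sumr_ge0 => j _; apply: sumr_ge0 => i _; apply: sqr_ge0.
  congr normc; rewrite rmorph_sum; apply: eq_bigr => j _.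
  by rewrite rmorph_sum; apply: eq_bigr => i _; rewrite -normc_sqr.
rewrite !diag !pair_bigA tE pair_bigA /=.
apply: le_trans (cauchy_schwarz_sum
  (fun p => normc ((X *m t) p.2 p.1)) (fun p => normc ((Y *m t) p.2 p.1))).
rewrite ler_pXn2r ?nnegrE ?normc_ge0 //; last first.
  by apply: sumr_ge0 => p _; rewrite mulr_ge0 ?normc_ge0.
apply: le_trans (normc_sum _ _ _) _; apply: ler_sum => p _.
by rewrite Normc.normcM normc_conj.
Qed.

(** With t_j the columns of t, the state of A is the sum of the <t_j, A t_j>, and the |t_j|^2 add up
    to the state of the identity, which is 1. *)
Lemma state_le_opnorm A : normc (state_of rho A) <= opnorm A.
Proof.
have [t tE] := state_hilbert_schmidt.
have colE j (B : 'M[R[i]]_n) i : (B *m t) i j = (B *m col j t) i 0.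
  by rewrite !mxE; apply: eq_bigr => k _; rewrite !mxE.
have tr1 : \sum_j l2norm (col j t) ^+ 2 = 1.
  apply: (@complexI R); rewrite rmorph1 -state1 -{1}(mul1mx 1%:M) -{1}adjmx1 tE.
  rewrite rmorph_sum; apply: eq_bigr => j _.
  rewrite l2norm_sqr rmorph_sum; apply: eq_bigr => i _.
  by rewrite mul1mx -normc_sqr mxE.
have -> : A = 1%:M ^t* *m A by rewrite adjmx1 mul1mx.
rewrite tE; apply: le_trans (normc_sum _ _ _) _.
rewrite adjmx1 mul1mx -[leRHS]mulr1 -tr1 mulr_sumr; apply: ler_sum => j _.
apply: le_trans (normc_sum _ _ _) _.
apply: (@le_trans _ _ (l2norm (col j t) * l2norm (A *m col j t))).
  apply: le_trans (l2norm_inner _ _); rewrite le_eqVlt; apply/orP; left.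
  apply/eqP/eq_bigr => i _; rewrite Normc.normcM normc_conj !colE mul1mx.
  by [].
rewrite mulrC expr2 mulrA ler_wpM2r ?l2norm_ge0 //.
exact: l2norm_opnorm.
Qed.

End FixedState.
End States.

(** * Operators embedded into a tensor product *)

Lemma ler_sum_inj (R : numDomainType) (I J : finType) (P : pred I) (h : I -> J)
    (G : J -> R) :
  {in P &, injective h} -> (forall j, 0 <= G j) ->
  \sum_(i | P i) G (h i) <= \sum_j G j.
Proof.
move=> h_inj G0.
have -> : \sum_(i | P i) G (h i) = \sum_(j in h @: P) G j by rewrite big_imset.
by rewrite [leRHS](bigID [in h @: P]) /= lerDl sumr_ge0.
Qed.

Section Embed.
Variables (R : realType) (q : nat) (T : finType).
Implicit Types s t u : {ffun T -> 'I_q}.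

Definition agree_off (D : pred T) s t := [forall y, ~~ D y ==> (s y == t y)].

Arguments agree_off : simpl never.

Lemma agree_offP (D : pred T) s t :
  reflect (forall y, ~~ D y -> s y = t y) (agree_off D s t).
Proof.
apply: (iffP forallP) => h y; first by move=> yD; apply/eqP/(implyP (h y)).
by apply/implyP => /h ->.
Qed.

Lemma embedE (S : finType) (f : S -> T) (a : op R q S) s t :
  embed f a (enum_rank s) (enum_rank t)
  = if agree_off (fun y => y \in codom f) s t
    then a (enum_rank [ffun x => s (f x)]) (enum_rank [ffun x => t (f x)]) else 0.
Proof. by rewrite mxE /= !enum_rankK. Qed.

Lemma op_eqP (A B : op R q T) :
  (forall s t, A (enum_rank s) (enum_rank t) = B (enum_rank s) (enum_rank t)) ->
  A = B.
Proof.
by move=> h; apply/matrixP => i j; rewrite -(enum_valK i) -(enum_valK j) h.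
Qed.

Lemma sum_enum_rank (V : nmodType) (F : 'I_#|{ffun T -> 'I_q}| -> V) :
  \sum_i F i = \sum_(s : {ffun T -> 'I_q}) F (enum_rank s).
Proof. by rewrite (reindex (@enum_rank _)) //; apply/onW_bij/enum_rank_bij. Qed.

Lemma embedM_disjoint (S S' : finType) (f : S -> T) (g : S' -> T)
    (a : op R q S) (b : op R q S') s u :
  [disjoint codom f & codom g]%B ->
  (embed f a *m embed g b) (enum_rank s) (enum_rank u)
  = if agree_off (fun y => (y \in codom f) || (y \in codom g)) s u
    then a (enum_rank [ffun x => s (f x)]) (enum_rank [ffun x => u (f x)])
         * b (enum_rank [ffun x => s (g x)]) (enum_rank [ffun x => u (g x)])
    else 0.
Proof.
move=> dis; rewrite mxE sum_enum_rank.
have g_notin y : y \in codom g -> y \notin codom f.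
  by move=> yg; apply/negP => yf; move/pred0P/(_ y): dis; rewrite /= yf yg.
(* The left factor changes only sites in [codom f], the right one only sites in [codom g], so no
   other intermediate configuration contributes. *)
pose t0 : {ffun T -> 'I_q} := [ffun y => if y \in codom f then u y else s y].
have t0f : [ffun x => t0 (f x)] = [ffun x => u (f x)] :> {ffun S -> 'I_q}.
  by apply/ffunP => x; rewrite !ffunE codom_f.
have t0g : [ffun x => t0 (g x)] = [ffun x => s (g x)] :> {ffun S' -> 'I_q}.
  by apply/ffunP => x; rewrite !ffunE (negbTE (g_notin _ _)) ?codom_f.
rewrite (bigD1 t0) //= big1 ?addr0 => [|t tt0].
  rewrite !embedE t0f t0g.
  have -> : agree_off (fun y => y \in codom f) s t0.
    by apply/agree_offP => y; rewrite ffunE => /negbTE ->.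
  have -> : agree_off (fun y => y \in codom g) t0 u
          = agree_off (fun y => (y \in codom f) || (y \in codom g)) s u.
    apply/agree_offP/agree_offP => h y.
      rewrite negb_or => /andP[yf yg].
      by have := h y yg; rewrite ffunE (negbTE yf).
    rewrite ffunE => yg; case: ifP => // /negbT yf.
    by apply: h; rewrite negb_or yf.
  by case: ifP => _ //; rewrite mulr0.
rewrite !embedE; case: ifP => [/agree_offP h1|]; last by rewrite mul0r.
case: ifP => [/agree_offP h2|]; last by rewrite mulr0.
case/eqP: tt0; apply/ffunP => y; rewrite ffunE; case: ifPn => yf; last first.
  by rewrite h1.
by apply: h2; apply/negP => /g_notin; rewrite yf.
Qed.

Lemma embed_comm (S S' : finType) (f : S -> T) (g : S' -> T)
    (a : op R q S) (b : op R q S') :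
  [disjoint codom f & codom g]%B ->
  embed f a *m embed g b = embed g b *m embed f a.
Proof.
move=> dis; apply: op_eqP => s u; rewrite !embedM_disjoint //; last first.
  by rewrite disjoint_sym.
have -> : agree_off (fun y => (y \in codom f) || (y \in codom g)) s u
        = agree_off (fun y => (y \in codom g) || (y \in codom f)) s u.
  by apply: eq_forallb => y; rewrite orbC.
by case: ifP => // _; rewrite mulrC.
Qed.

Lemma embed_adj (S : finType) (f : S -> T) (a : op R q S) :
  (embed f a) ^t* = embed f (a ^t*).
Proof.
apply: op_eqP => s t; rewrite [LHS]mxE [X in Num.conj X]mxE !embedE.
have -> : agree_off (fun y => y \in codom f) t s = agree_off (fun y => y \in codom f) s t.
  by apply: eq_forallb => y; rewrite eq_sym.
by case: ifP => _; rewrite ?conjC0 // !mxE.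
Qed.

Lemma embed1 (S : finType) (f : S -> T) :
  embed f (1%:M : op R q S) = 1%:M.
Proof.
apply: op_eqP => s t; rewrite embedE !mxE !(inj_eq enum_rank_inj).
have [<-|ne] := eqVneq s t.
  have -> : agree_off (fun y => y \in codom f) s s by apply/agree_offP.
  by rewrite eqxx.
case: ifP => // /agree_offP h; case: eqP => // /ffunP e; case/eqP: ne.
apply/ffunP => y; case: (boolP (y \in codom f)) => [/codomP[x ->]|/h //].
by have := e x; rewrite !ffunE.
Qed.

(** A crude bound for the norm; what matters is that it is computed before embedding and so does not
    depend on the volume. *)
Definition abs_sum n (a : 'M[R[i]]_n) : R := \sum_i \sum_j normc (a i j).

Lemma abs_sum_ge0 n (a : 'M[R[i]]_n) : 0 <= abs_sum a.
Proof. by apply: sumr_ge0 => i _; apply: sumr_ge0 => j _; apply: normc_ge0. Qed.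

(** The nonzero entries of a row have a fixed configuration outside [codom f], so they come from
    distinct positions in a single row of [a]. *)
Lemma embed_row_sum (S : finType) (f : S -> T) (a : op R q S) i :
  \sum_j normc (embed f a i j) <= abs_sum a.
Proof.
rewrite -(enum_valK i) sum_enum_rank; move: (enum_val i) => s.
pose r t : {ffun S -> 'I_q} := [ffun x => t (f x)].
pose G j := normc (a (enum_rank (r s)) j).
have G0 j : 0 <= G j by apply: normc_ge0.
apply: (@le_trans _ _ (\sum_j G j)); last first.
  rewrite /abs_sum [leRHS](bigD1 (enum_rank (r s))) //= lerDl.
  by apply: sumr_ge0 => k _; apply: sumr_ge0 => j _; apply: normc_ge0.
under eq_bigr do rewrite embedE (fun_if (@Normc.normc R)) Normc.normc0.
rewrite -big_mkcond /=.
apply: (@ler_sum_inj _ _ _ _ (fun t => enum_rank (r t))) => // t u.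
rewrite !unfold_in => /agree_offP ht /agree_offP hu /enum_rank_inj/ffunP e.
apply/ffunP => y; case: (boolP (y \in codom f)) => [/codomP[x ->]|yf].
  by have := e x; rewrite !ffunE.
by rewrite -ht // hu.
Qed.

(** Schur test; the column sums are row sums of the adjoint. The bound covers every f, hence also
    small cubes on which the projection of the support is not injective. *)
Lemma embed_opnorm (S : finType) (f : S -> T) (a : op R q S) :
  opnorm (embed f a) <= abs_sum a.
Proof.
apply: opnorm_le (abs_sum_ge0 a) _.
apply: l2norm_schur => [i|j]; first exact: embed_row_sum.
have -> : abs_sum a = abs_sum (a ^t*).
  rewrite /abs_sum exchange_big; apply: eq_bigr => i _; apply: eq_bigr => k _.
  by rewrite !mxE normc_conj.
apply: le_trans (embed_row_sum f (a ^t*) j); rewrite le_eqVlt; apply/orP; left.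
by apply/eqP/eq_bigr => i _; rewrite -embed_adj !mxE normc_conj.
Qed.

Lemma supported_comm (S S' : {set T}) (A B : op R q T) :
  supported S A -> supported S' B -> [disjoint S & S']%B -> A *m B = B *m A.
Proof.
move=> [a ->] [b ->] dis; apply: embed_comm.
apply/pred0P => y /=; apply/negP => /andP[/codomP[x ->] /codomP[z e]].
by move/pred0P/(_ (val x)): dis; rewrite /= (valP x) e (valP z).
Qed.

Lemma supported_adj (S : {set T}) (A : op R q T) :
  supported S A -> supported S (A ^t*).
Proof. by move=> [a ->]; exists (a ^t*); rewrite embed_adj. Qed.

End Embed.

(** * Lindblad terms *)

(** Entry rules for the linear operations only. Unlike [mxE] they leave products folded, so [ring]
    sees entries of products as atoms. *)
Lemma mx_addE (R : nzRingType) m p (A B : 'M[R]_(m, p)) i j : (A + B) i j = A i j + B i j.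
Proof. by rewrite mxE. Qed.

Lemma mx_oppE (R : nzRingType) m p (A : 'M[R]_(m, p)) i j : (- A) i j = - A i j.
Proof. by rewrite mxE. Qed.

Lemma mx_scaleE (R : nzRingType) m p c (A : 'M[R]_(m, p)) i j : (c *: A) i j = c * A i j.
Proof. by rewrite mxE. Qed.

Lemma mx_zeroE (R : nzRingType) m p i j : (0 : 'M[R]_(m, p)) i j = 0.
Proof. by rewrite mxE. Qed.

Ltac mx_linear tac :=
  apply/matrixP => ? ?; rewrite !(mx_addE, mx_oppE, mx_scaleE, mx_zeroE); tac.

Section Lindblad.
(* Over an abstract field unification is much cheaper than over R[i]. *)
Variables (C : numClosedFieldType) (n : nat).
Implicit Types (A B F H K : 'M[C]_n) (Ls : seq 'M[C]_n).

Definition gen_lindblad H Ls A : 'M[C]_n :=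
  'i *: (H *m A - A *m H)
  + \sum_(K <- Ls)
      (K *m A *m K ^t* - 2^-1 *: (K *m K ^t* *m A + A *m (K *m K ^t*))).

Lemma mx_exprS A k : A ^+ k.+1 = A *m A ^+ k.
Proof. exact: exprS. Qed.

Lemma lindblad_linear H Ls c A B :
  gen_lindblad H Ls (c *: A + B) = c *: gen_lindblad H Ls A + gen_lindblad H Ls B.
Proof.
rewrite /gen_lindblad.
rewrite [in RHS]scalerDr addrACA scaler_sumr -big_split /=; congr (_ + _).
  rewrite !(mulmxDl, mulmxDr) -!(scalemxAl, scalemxAr).
  mx_linear ltac:(ring).
apply: eq_bigr => K _; rewrite !(mulmxDl, mulmxDr) -!(scalemxAl, scalemxAr).
mx_linear ltac:(ring).
Qed.

Lemma lindblad0 H Ls : gen_lindblad H Ls 0 = 0.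
Proof.
have := lindblad_linear H Ls 1 0 0; rewrite !scale1r addr0.
by move/esym/eqP; rewrite -subr_eq0 addrK => /eqP.
Qed.

Lemma lindbladD H Ls A B :
  gen_lindblad H Ls (A + B) = gen_lindblad H Ls A + gen_lindblad H Ls B.
Proof. by have := lindblad_linear H Ls 1 A B; rewrite !scale1r. Qed.

Lemma lindbladN H Ls A : gen_lindblad H Ls (- A) = - gen_lindblad H Ls A.
Proof.
have := lindblad_linear H Ls (-1) A 0.
by rewrite lindblad0 !addr0 !scaleN1r.
Qed.

Lemma lindbladB H Ls A B :
  gen_lindblad H Ls (A - B) = gen_lindblad H Ls A - gen_lindblad H Ls B.
Proof. by rewrite lindbladD lindbladN. Qed.

Lemma lindblad1 H Ls : gen_lindblad H Ls 1%:M = 0.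
Proof.
rewrite /gen_lindblad.
rewrite !mulmx1 mul1mx subrr scaler0 add0r big1 // => K _.
rewrite !mulmx1 !mul1mx.
by mx_linear ltac:(field).
Qed.

Lemma lindblad_adj H Ls A : H \is hermsymmx ->
  (gen_lindblad H Ls A) ^t* = gen_lindblad H Ls (A ^t*).
Proof.
move=> /is_hermitianmxP; rewrite expr0 scale1r => HE.
have half : Num.conj (2^-1 : C) = 2^-1 by rewrite fmorphV rmorph_nat.
rewrite /gen_lindblad adjmxD adjmx_sum.
congr (_ + _).
  rewrite adjmxZ conjCi adjmxD adjmxN !adjmxM -HE.
  mx_linear ltac:(ring).
apply: eq_bigr => K _.
rewrite adjmxD adjmxN adjmxZ half adjmxD !adjmxM !trmxCK !mulmxA.
mx_linear ltac:(ring).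
Qed.

(** The commutant of H, the jump operators and their adjoints: an algebraic substitute for a support
    away from the term. *)
Definition commutes_gens H Ls F : Prop :=
  H *m F = F *m H /\
  forall K, K \in Ls -> K *m F = F *m K /\ K ^t* *m F = F *m K ^t*.

(** F can be moved to the right end of every summand, so the term is a module map over this
    commutant. *)
Lemma lindblad_mulr H Ls A F : commutes_gens H Ls F ->
  gen_lindblad H Ls (A *m F) = gen_lindblad H Ls A *m F.
Proof.
move=> [HF KF]; rewrite /gen_lindblad.
rewrite mulmxDl mulmx_suml; congr (_ + _).
  by rewrite -scalemxAl mulmxBl -!mulmxA HF.
apply: eq_big_seq => K /KF[KF1 KF2].
have e1 : K *m (A *m F) *m K ^t* = K *m A *m K ^t* *m F.
  by rewrite -!mulmxA KF2.
have e2 : A *m F *m (K *m K ^t*) = A *m (K *m K ^t*) *m F.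
  by rewrite -!mulmxA (mulmxA F) -KF1 -mulmxA -KF2.
by rewrite mulmxBl -scalemxAl mulmxDl e1 e2 (mulmxA _ A F).
Qed.

Lemma lindblad_mull H Ls A F : commutes_gens H Ls F ->
  gen_lindblad H Ls (F *m A) = F *m gen_lindblad H Ls A.
Proof.
move=> [HF KF]; rewrite /gen_lindblad.
rewrite mulmxDr mulmx_sumr; congr (_ + _).
  by rewrite -scalemxAr mulmxBr !mulmxA HF.
apply: eq_big_seq => K /KF[KF1 KF2].
have e1 : K *m (F *m A) *m K ^t* = F *m (K *m A *m K ^t*).
  by rewrite !mulmxA KF1.
have e2 : K *m K ^t* *m (F *m A) = F *m (K *m K ^t* *m A).
  by rewrite mulmxA -(mulmxA K _ F) KF2 !mulmxA KF1.
by rewrite mulmxBr -scalemxAr mulmxDr e1 e2 -(mulmxA F A).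
Qed.

(** A generator F of the first term commutes with those of the second, so L'[F A] = F L'[A] and
    L'[A F] = L'[A] F: the second term preserves the commutant of the first. *)
Lemma commutes_gens_lindblad H Ls H' Ls' A :
  commutes_gens H Ls A -> commutes_gens H' Ls' H ->
  (forall K, K \in Ls -> commutes_gens H' Ls' K /\ commutes_gens H' Ls' (K ^t*)) ->
  commutes_gens H Ls (gen_lindblad H' Ls' A).
Proof.
move=> [HA KA] HH KK.
have comm F : commutes_gens H' Ls' F -> F *m A = A *m F ->
    F *m gen_lindblad H' Ls' A = gen_lindblad H' Ls' A *m F.
  by move=> cF FA; rewrite -lindblad_mull // FA lindblad_mulr.
split; first exact: comm.
by move=> K KL; have [c1 c2] := KK K KL; have [e1 e2] := KA K KL; split; apply: comm.
Qed.

Section CommutesGens.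
Variables (H : 'M[C]_n) (Ls : seq 'M[C]_n).
Local Notation cg := (commutes_gens H Ls).

Lemma commutes_gens0 : cg 0.
Proof. by split=> [|K _]; rewrite ?mulmx0 ?mul0mx. Qed.

Lemma commutes_gens1 : cg 1%:M.
Proof. by split=> [|K _]; rewrite ?mulmx1 ?mul1mx. Qed.

Lemma commutes_gensD A B : cg A -> cg B -> cg (A + B).
Proof.
move=> [a a'] [b b']; split=> [|K KL]; first by rewrite mulmxDl mulmxDr a b.
have [a1 a2] := a' K KL; have [b1 b2] := b' K KL.
by rewrite !mulmxDl !mulmxDr a1 a2 b1 b2.
Qed.

Lemma commutes_gensZ c A : cg A -> cg (c *: A).
Proof.
move=> [a a']; split=> [|K KL]; first by rewrite -scalemxAl -scalemxAr a.
by have [a1 a2] := a' K KL; rewrite -!scalemxAl -!scalemxAr a1 a2.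
Qed.

Lemma commutes_gensM A B : cg A -> cg B -> cg (A *m B).
Proof.
move=> [a a'] [b b']; split=> [|K KL]; first by rewrite mulmxA a -!mulmxA b.
have [a1 a2] := a' K KL; have [b1 b2] := b' K KL.
by rewrite !mulmxA a1 a2 -!mulmxA b1 b2.
Qed.

Lemma commutes_gensX A k : cg A -> cg (A ^+ k).
Proof.
move=> cA; elim: k => [|k IH]; first exact: commutes_gens1.
by rewrite mx_exprS; apply: commutes_gensM.
Qed.

Lemma commutes_gens_sum (I : finType) (P : pred I) (F : I -> 'M[C]_n) :
  (forall i, P i -> cg (F i)) -> cg (\sum_(i | P i) F i).
Proof.
by move=> h; apply: big_ind => //; [exact: commutes_gens0 | exact: commutes_gensD].
Qed.

Lemma commutes_gens_adj A : H \is hermsymmx -> cg A -> cg (A ^t*).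
Proof.
move=> /is_hermitianmxP; rewrite expr0 scale1r => HE [a a'].
have adj X : X *m A = A *m X -> X ^t* *m A ^t* = A ^t* *m X ^t*.
  by move=> e; rewrite -!adjmxM e.
split; first by rewrite HE; apply: adj.
by move=> K /a'[/adj a1 /adj]; rewrite trmxCK.
Qed.

Lemma lindblad_far A : cg A -> gen_lindblad H Ls A = 0.
Proof. by move=> cA; rewrite -[A]mul1mx lindblad_mulr // lindblad1 mul0mx. Qed.

Lemma lindblad_sub_far A B F : cg B -> cg F ->
  gen_lindblad H Ls (A - B + F) = gen_lindblad H Ls A.
Proof.
move=> cB cF; rewrite lindbladD lindbladB (lindblad_far cB) (lindblad_far cF).
by rewrite subr0 addr0.
Qed.

End CommutesGens.

(** Separates the sites outside p, which will be few, from those inside, where only A - B enters. *)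
Lemma sum_lindblad_diff (T : finType) (h : T -> 'M[C]_n) (l : T -> seq 'M[C]_n)
    (p : pred T) A B :
  \sum_y gen_lindblad (h y) (l y) A - \sum_(y | p y) gen_lindblad (h y) (l y) B
  = \sum_(y | ~~ p y) gen_lindblad (h y) (l y) A
    + \sum_(y | p y) gen_lindblad (h y) (l y) (A - B).
Proof.
rewrite [X in _ = _ + X](eq_bigr _ (fun y _ => lindbladB (h y) (l y) A B)).
rewrite sumrB (bigID p) /= addrA; congr (_ - _); exact: addrC.
Qed.

(** The defect of the Leibniz rule, taken bilinear: the first argument is not replaced by its
    adjoint. *)
Definition carre_du_champ H Ls A B : 'M[C]_n :=
  gen_lindblad H Ls (A *m B) - gen_lindblad H Ls A *m B - A *m gen_lindblad H Ls B.

Section CarreDuChamp.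
Variables (H : 'M[C]_n) (Ls : seq 'M[C]_n).
Local Notation gam := (carre_du_champ H Ls).

Lemma carre_du_champE A B :
  gen_lindblad H Ls (A *m B)
  = gen_lindblad H Ls A *m B + A *m gen_lindblad H Ls B + gam A B.
Proof. rewrite /carre_du_champ; mx_linear ltac:(ring). Qed.

Lemma carre_du_champBr A B D : gam A (B - D) = gam A B - gam A D.
Proof.
rewrite /carre_du_champ mulmxBr !lindbladB !mulmxBr.
mx_linear ltac:(ring).
Qed.

Lemma carre_du_champBl A B D : gam (B - D) A = gam B A - gam D A.
Proof.
rewrite /carre_du_champ mulmxBl !lindbladB !mulmxBl.
mx_linear ltac:(ring).
Qed.

Lemma carre_du_champ_farr A F : commutes_gens H Ls F -> gam A F = 0.
Proof.
move=> cF.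
by rewrite /carre_du_champ lindblad_mulr // (lindblad_far cF) mulmx0 subrr subr0.
Qed.

Lemma carre_du_champ_farl A F : commutes_gens H Ls F -> gam F A = 0.
Proof.
move=> cF; rewrite /carre_du_champ lindblad_mull // (lindblad_far cF) mul0mx subr0.
by rewrite subrr.
Qed.

End CarreDuChamp.

(** * First and second differences of powers *)

Lemma exp_diffS A B k :
  A ^+ k.+1 - B ^+ k.+1 = A *m (A ^+ k - B ^+ k) + (A - B) *m B ^+ k.
Proof. by rewrite !mx_exprS mulmxBr mulmxBl addrA subrK. Qed.

(** The hypothesis makes X, A, B, F the corners of a parallelogram. The second difference then obeys
    a recursion whose inhomogeneous part consists of products of two first differences. *)
Lemma exp_diff2S X A B F k : X - B = A - F ->
  X ^+ k.+1 - A ^+ k.+1 - B ^+ k.+1 + F ^+ k.+1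
  = X *m (X ^+ k - A ^+ k - B ^+ k + F ^+ k)
    + ((X - A) *m (A ^+ k - F ^+ k) + (X - B) *m (B ^+ k - F ^+ k)).
Proof.
move=> e2.
have -> : (X - A) *m (A ^+ k - F ^+ k) + (X - B) *m (B ^+ k - F ^+ k)
   = (X - A) *m A ^+ k + (X - B) *m B ^+ k - ((X - A) + (A - F)) *m F ^+ k.
  rewrite -e2 !mulmxBr !mulmxDl.
  mx_linear ltac:(ring).
rewrite !mx_exprS !(mulmxDl, mulmxDr, mulmxN, mulNmx).
mx_linear ltac:(ring).
Qed.

End Lindblad.

Lemma lindblad_termE (R : realType) n (H : 'M[R[i]]_n) Ls A :
  lindblad_term H Ls A = gen_lindblad H Ls A.
Proof. by []. Qed.

Section PowerDifferences.
Variables (R : realType) (n : nat).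
Implicit Types A B X F : 'M[R[i]]_n.

(** Telescoping; 1 <= a allows a^k in place of a^(k-1). *)
Lemma exp_diff_le A B a d k : 1 <= a -> opnorm A <= a -> opnorm B <= a ->
  opnorm (A - B) <= d -> opnorm (A ^+ k - B ^+ k) <= k%:R * a ^+ k * d.
Proof.
move=> a1 hA hB hd; have a0 : 0 <= a by apply: le_trans a1.
have d0 : 0 <= d by apply: le_trans hd; apply: opnorm_ge0.
elim: k => [|k IH]; first by rewrite !expr0 subrr opnorm0 !mul0r.
rewrite exp_diffS; apply: le_trans (opnormD _ _) _.
have h1 := opnormM_le hA IH; have h2 := opnormM_le hd (opnormX_le k hB).
apply: le_trans (lerD h1 h2) _.
rewrite -natr1 exprS.
have -> : (k%:R + 1) * (a * a ^+ k) * d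
        = a * (k%:R * a ^+ k * d) + a * (d * a ^+ k) by ring.
by rewrite lerD2l ler_peMl // mulr_ge0 // exprn_ge0.
Qed.

(** Each step of the recursion adds a multiple 2 k of d^2, and k^2 + 2 k <= (k + 1)^2. *)
Lemma exp_diff2_le X A B F a d k : 1 <= a ->
  opnorm X <= a -> opnorm A <= a -> opnorm B <= a -> opnorm F <= a ->
  X - A = B - F -> X - B = A - F ->
  opnorm (X - A) <= d -> opnorm (X - B) <= d ->
  opnorm (X ^+ k - A ^+ k - B ^+ k + F ^+ k) <= k%:R ^+ 2 * a ^+ k * d ^+ 2.
Proof.
move=> a1 hX hA hB hF e1 e2 d1 d2; have a0 : 0 <= a by apply: le_trans a1.
have d0 : 0 <= d by apply: le_trans d1; apply: opnorm_ge0.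
elim: k => [|k IH].
  by rewrite !expr0 subrr sub0r addNr opnorm0 expr0n /= !mul0r.
rewrite exp_diff2S; last exact: e2.
apply: le_trans (opnormD _ _) _.
have h1 := opnormM_le hX IH.
have d3 := d2; have d4 := d1; rewrite e2 in d3; rewrite e1 in d4.
have h2 := exp_diff_le k a1 hA hF d3; have h3 := exp_diff_le k a1 hB hF d4.
have h4 := le_trans (opnormD _ _) (lerD (opnormM_le d1 h2) (opnormM_le d2 h3)).
apply: le_trans (lerD h1 h4) _.
have K0 : 0 <= k%:R :> R by apply: ler0n.
rewrite -natr1 [a ^+ k.+1]exprS; set E := a ^+ k; have E0 : 0 <= E by apply: exprn_ge0.
have -> : (k%:R + 1) ^+ 2 * (a * E) * d ^+ 2
  = a * (k%:R ^+ 2 * E * d ^+ 2) + a * (d * (k%:R * E * d) + d * (k%:R * E * d))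
    + a * E * d ^+ 2 by ring.
rewrite -addrA lerD2l -[leLHS]addr0 lerD //.
  by rewrite ler_peMl // addr_ge0 // !mulr_ge0.
by rewrite !mulr_ge0 ?sqr_ge0.
Qed.

End PowerDifferences.

(** * Estimates in a fixed volume *)

Lemma card_neighbours (T : finType) (A : pred T) (e : rel T) a m :
  (#|A| <= a)%N -> (forall z, #|e z| <= m)%N ->
  (#|[pred y | [exists z, A z && e z y]]| <= a * m)%N.
Proof.
move=> hA he.
apply: (@leq_trans #|(\bigcup_(z in A) [set y | e z y])%SET|).
  apply/subset_leq_card/fintype.subsetP => y; rewrite inE => /existsP[z /andP[Az zy]].
  by apply/finset.bigcupP; exists z => //; rewrite inE.
apply: (@leq_trans (\sum_(z in A) m)).
  elim/big_rec2: _ => [|z k B _ h]; first by rewrite cards0.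
  by apply: leq_trans (leq_card_setU _ _) _; apply: leq_add => //; rewrite cardsE.
by rewrite sum_nat_const leq_mul2r hA orbT.
Qed.

Section FiniteVolume.
Variables (R : realType) (n : nat) (T : finType).
Variables (H : T -> 'M[R[i]]_n) (Ls : T -> seq 'M[R[i]]_n) (rho : 'M[R[i]]_n).
(** [ov x y] marks sites whose terms may fail to commute, D bounds the number of such neighbours,
    and nu is the inverse volume. The constants below do not depend on the volume. *)
Variables (ov : rel T) (D : nat) (a b nu : R).
Local Notation lt x := (gen_lindblad (H x) (Ls x)).
Let Lv (A : 'M[R[i]]_n) : 'M[R[i]]_n := \sum_x lt x A.
Local Notation cg x := (commutes_gens (H x) (Ls x)).

Hypothesis H_herm : forall x, H x \is hermsymmx.
Hypothesis b_ge0 : 0 <= b.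
Hypothesis term_bound : forall x A, opnorm (lt x A) <= b * opnorm A.
Hypothesis rho_dm : density_matrix rho.
Hypothesis rev : reversible rho Lv.
Hypothesis ov_refl : forall x, ov x x.
Hypothesis ov_sym : symmetric ov.
Hypothesis ov_card : forall x, (#|ov x| <= D)%N.
Hypothesis gens_far : forall x y, ~~ ov x y ->
  cg y (H x) /\ forall K, K \in Ls x -> cg y K /\ cg y (K ^t*).
Hypothesis a_ge1 : 1 <= a.
Hypothesis nuE : nu * #|T|%:R = 1.
Hypothesis nu_ge0 : 0 <= nu.

(* The site terms of an extensive quantity divided by the volume. *)
Definition site_terms (w : T -> 'M[R[i]]_n) : Prop :=
  (forall y, opnorm (w y) <= a * nu) /\
  (forall x y, ~~ ov x y -> cg x (w y)).

Lemma site_terms_adj w : site_terms w -> site_terms (fun y => (w y) ^t*).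
Proof.
move=> [h1 h2]; split=> [y|x y /h2].
  by apply: le_trans (opnorm_adj _) _.
exact: commutes_gens_adj.
Qed.

Let a_ge0 : 0 <= a. Proof. exact: le_trans a_ge1. Qed.

Let psum (w : T -> 'M[R[i]]_n) (p : pred T) := \sum_(z | p z) w z.

Lemma psum_le w p : site_terms w -> opnorm (psum w p) <= a.
Proof.
move=> [h _]; apply: (@le_trans _ _ (#|T|%:R * (a * nu))).
  by apply: opnorm_sum_le => //; [exact: mulr_ge0 | exact: max_card].
by rewrite mulrC -mulrA nuE mulr1.
Qed.

Lemma psum_near w (p : pred T) x : site_terms w -> (forall z, p z -> ov x z) ->
  opnorm (psum w p) <= D%:R * (a * nu).
Proof.
move=> [h _] px; apply: opnorm_sum_le => //; first exact: mulr_ge0.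
by apply: leq_trans (ov_card x); apply/subset_leq_card/fintype.subsetP => z; apply: px.
Qed.

Lemma psum_far w (p : pred T) x : site_terms w -> (forall z, p z -> ~~ ov x z) ->
  cg x (psum w p).
Proof. by move=> [_ h] px; apply: commutes_gens_sum => z /px; apply: h. Qed.

Let far x : pred T := fun z => ~~ ov x z.
Let total (w : T -> 'M[R[i]]_n) : 'M[R[i]]_n := \sum_z w z.

Lemma total_le w : site_terms w -> opnorm (total w) <= a.
Proof. exact: (@psum_le w predT). Qed.

Lemma total_diff w (p : pred T) : total w - psum w p = psum w (fun z => ~~ p z).
Proof. by rewrite /total /psum (bigID p) /= addrAC subrr add0r. Qed.

Lemma total_far w x : site_terms w ->
  opnorm (total w - psum w (far x)) <= D%:R * (a * nu).
Proof.
by move=> hw; rewrite total_diff; apply: (@psum_near _ _ x) => // z; rewrite negbK.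
Qed.

(** The bound of [exp_diff_le] for removing the at most D site terms near one site, with nu split
    off. *)
Definition diff_const (k : nat) : R := k%:R * a ^+ k * (D%:R * a).

Lemma diff_const_ge0 k : 0 <= diff_const k.
Proof. by rewrite !mulr_ge0 // exprn_ge0. Qed.

Arguments diff_const : simpl never.

Lemma total_pow_far w x k : site_terms w ->
  opnorm (total w ^+ k - psum w (far x) ^+ k) <= diff_const k * nu.
Proof.
move=> hw; have -> : diff_const k * nu = k%:R * a ^+ k * (D%:R * (a * nu)).
  by rewrite /diff_const; ring.
exact: exp_diff_le a_ge1 (total_le hw) (psum_le _ hw) (total_far x hw).
Qed.

(** Without the site terms near x the power is killed by the term at x, so only the O(nu) difference
    is seen. *)
Lemma term_pow_le w x k : site_terms w ->
  opnorm (lt x (total w ^+ k)) <= b * (diff_const k * nu).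
Proof.
move=> hw.
have -> : lt x (total w ^+ k) = lt x (total w ^+ k - psum w (far x) ^+ k).
  rewrite lindbladB (@lindblad_far _ _ _ _ (psum w (far x) ^+ k)) ?subr0 //.
  by apply/commutes_gensX/psum_far.
apply: le_trans (term_bound _ _) _.
by rewrite ler_wpM2l ?total_pow_far.
Qed.

Local Notation gam x := (carre_du_champ (H x) (Ls x)).

Lemma gam_le x A B c d : opnorm A <= c -> opnorm B <= d ->
  opnorm (gam x A B) <= 3 * b * c * d.
Proof.
move=> hA hB; rewrite /carre_du_champ.
have c0 : 0 <= c by apply: le_trans hA; apply: opnorm_ge0.
have d0 : 0 <= d by apply: le_trans hB; apply: opnorm_ge0.
have e (X : 'M[R[i]]_n) u : opnorm X <= u -> opnorm (lt x X) <= b * u.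
  by move=> h; apply: le_trans (term_bound _ _) _; rewrite ler_wpM2l.
have h1 := e _ _ (opnormM_le hA hB).
have h2 := opnormM_le (e _ _ hA) hB.
have h3 := opnormM_le hA (e _ _ hB).
apply: le_trans (opnormB _ _) _; apply: le_trans (lerD (opnormB _ _) (lexx _)) _.
apply: le_trans (lerD (lerD h1 h2) h3) _.
by rewrite le_eqVlt; apply/orP; left; apply/eqP; ring.
Qed.

Lemma gam_pow_le_r w x k A c : site_terms w -> opnorm A <= c ->
  opnorm (gam x A (total w ^+ k)) <= 3 * b * c * (diff_const k * nu).
Proof.
move=> hw hA; have cF : cg x (psum w (far x) ^+ k).
  by apply/commutes_gensX/psum_far.
rewrite -[gam _ _ _]subr0 -(carre_du_champ_farr A cF) -carre_du_champBr.
by apply: gam_le => //; apply: total_pow_far.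
Qed.

Lemma gam_pow_le_l w x k A c : site_terms w -> opnorm A <= c ->
  opnorm (gam x (total w ^+ k) A) <= 3 * b * (diff_const k * nu) * c.
Proof.
move=> hw hA; have cF : cg x (psum w (far x) ^+ k).
  by apply/commutes_gensX/psum_far.
rewrite -[gam _ _ _]subr0 -(carre_du_champ_farl A cF) -carre_du_champBl.
by apply: gam_le => //; apply: total_pow_far.
Qed.

(** Stronger than [~~ ov x y]: no site is near both, so removals around x and around y concern
    different site terms. *)
Let indep x y := ~~ [exists z, ov x z && ov y z].

Lemma indep_card x : (#|[pred y | ~~ indep x y]| <= D * D)%N.
Proof.
apply: leq_trans (@card_neighbours _ (ov x) ov _ _ (ov_card x) ov_card).
apply/subset_leq_card/fintype.subsetP => y; rewrite !inE negbK.
by under eq_existsb do rewrite (ov_sym y).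
Qed.

(** The first summand counts at most D^2 sites near x, each contributing O(nu); the second stands
    for up to volume many second differences of order nu^2. *)
Definition near_const (k : nat) : R :=
  (D * D)%:R * (b * diff_const k) + b * (k%:R ^+ 2 * a ^+ k * (D%:R * a) ^+ 2).

Lemma near_const_ge0 k : 0 <= near_const k.
Proof.
by rewrite addr_ge0 // !mulr_ge0 ?diff_const_ge0 ?sqr_ge0 // exprn_ge0.
Qed.

(* The term at y kills everything that commutes with its generators; hence for y
   far from x only a second difference of k-th powers survives, of size nu^2, and
   the volume many such terms add up to O(nu). *)
Lemma liouvillian_pow_far w x k : site_terms w ->
  exists2 F, cg x F & opnorm (Lv (total w ^+ k) - F) <= near_const k * nu.
Proof.
move=> hw; set Q := total w ^+ k.
(* The witness keeps only terms at sites independent of x, applied to the power without site terms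
   near x, so it commutes with the generators at x. *)
exists (\sum_(y | indep x y) lt y (psum w (far x) ^+ k)).
  apply: commutes_gens_sum => y xy.
  have nxy : ~~ ov x y.
    by apply: contra xy => xy; apply/existsP; exists y; rewrite xy ov_refl.
  have [g1 g2] := gens_far nxy.
  by apply: commutes_gens_lindblad => //; apply/commutes_gensX/psum_far.
rewrite /Lv sum_lindblad_diff.
rewrite mulrDl; apply: le_trans (opnormD _ _) _; apply: lerD.
  rewrite -(mulrA _ _ nu) -(mulrA b).
  apply: opnorm_sum_le; last exact: indep_card.
    by apply: mulr_ge0 => //; apply: mulr_ge0 => //; apply: diff_const_ge0.
  by move=> y _; apply: term_pow_le.
set e := k%:R ^+ 2 * a ^+ k * (D%:R * (a * nu)) ^+ 2.
have e0 : 0 <= e by rewrite !mulr_ge0 ?sqr_ge0 ?exprn_ge0.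
apply: (@le_trans _ _ (#|T|%:R * (b * e))); last first.
  have -> : #|T|%:R * (b * e)
    = b * (k%:R ^+ 2 * a ^+ k * (D%:R * a) ^+ 2) * nu * (nu * #|T|%:R).
    by rewrite /e; ring.
  by rewrite nuE mulr1.
apply: opnorm_sum_le; [exact: mulr_ge0 | | exact: max_card].
move=> y xy; pose p z := ~~ ov x z && ~~ ov y z.
have cF : cg y (psum w p ^+ k).
  by apply/commutes_gensX/psum_far => // z /andP[].
have cB : cg y (psum w (far y) ^+ k) by apply/commutes_gensX/psum_far.
(* Both inserted powers lack the site terms near y, hence are killed by the term at y; they complete
   the second difference. *)
rewrite -(lindblad_sub_far _ cB cF).
apply: le_trans (term_bound _ _) _; rewrite ler_wpM2l //.
(* As no site is near both u and v, all sites near u are far from v; this is the parallelogram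
   condition. *)
have split u v : ~~ [exists z, ov u z && ov v z] ->
    total w - psum w (far u) = psum w (far v) - psum w (fun z => ~~ ov u z && ~~ ov v z).
  move=> uv; rewrite total_diff [psum w (far v)]/psum (bigID (ov u)) /=.
  rewrite [X in _ = _ + X - _](_ : _ = psum w (fun z => ~~ ov u z && ~~ ov v z)).
    rewrite addrK; apply: eq_bigl => z; rewrite /far negbK.
    case: (boolP (ov u z)) => uz; rewrite ?andbF ?andbT //.
    by apply/esym; apply: contra uv => vz; apply/existsP; exists z; rewrite uz.
  by apply: eq_bigl => z; rewrite andbC.
have e1 := split x y xy.
have e2 : total w - psum w (far y) = psum w (far x) - psum w p.
  rewrite (split y x); last first.
    by apply: contra xy => /existsP[z]; rewrite andbC => h; apply/existsP; exists z.
  by congr (_ - _); apply: eq_bigl => z; rewrite andbC.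
exact: (exp_diff2_le k a_ge1 (total_le hw) (psum_le _ hw) (psum_le _ hw)
  (psum_le _ hw) e1 e2 (total_far x hw) (total_far y hw)).
Qed.

(** Reversibility against the identity: omega(1 L[A]) = omega(L[1] A) = 0. *)
Lemma state_liouvillian A : state_of rho (Lv A) = 0.
Proof.
have := rev 1%:M A; rewrite mul1mx => ->.
rewrite /Lv big1 => [|x _]; first by rewrite mul0mx /state_of mulmx0 mxtrace0.
exact: lindblad1.
Qed.

Lemma liouvillianM A B :
  Lv (A *m B) = Lv A *m B + A *m Lv B + \sum_x gam x A B.
Proof.
rewrite /Lv mulmx_suml mulmx_sumr -!big_split /=; apply: eq_bigr => x _.
exact: carre_du_champE.
Qed.

Definition energy_const k k' := 3 * b * near_const k * diff_const k'.

(* Reversibility turns <X, L Q> into -1/2 times the state of the carre du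
   champ of X and Q. *)
Lemma liouvillian_pow_inner w w' k k' : site_terms w -> site_terms w' ->
  normc (state_of rho (Lv (total w ^+ k) *m Lv (total w' ^+ k')))
  <= energy_const k k' * nu.
Proof.
move=> hw hw'; set X := Lv _; set Q := total w' ^+ k'.
(* Stationarity at X Q and the Leibniz rule; reversibility makes the two first-order terms equal. *)
have e : 2 * state_of rho (X *m Lv Q) = - state_of rho (\sum_x gam x X Q).
  have := state_liouvillian (X *m Q); rewrite liouvillianM !stateD -rev.
  by move/eqP; rewrite addr_eq0 => /eqP <-; rewrite -mulr2n mulr_natl.
have : normc (state_of rho (X *m Lv Q)) <= normc (2 * state_of rho (X *m Lv Q)).
  by rewrite Normc.normcM normc_nat ler_peMl ?normc_ge0 ?ler1n.
move/le_trans; apply; rewrite e normc_opp.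
apply: le_trans (state_le_opnorm rho_dm _) _.
have E0 : 0 <= energy_const k k'.
  apply: mulr_ge0 (diff_const_ge0 _); apply: mulr_ge0 (near_const_ge0 _).
  exact: mulr_ge0.
have -> : energy_const k k' * nu = #|T|%:R * (energy_const k k' * nu * nu).
  move: (energy_const k k') => E;
  have -> : #|T|%:R * (E * nu * nu) = E * nu * (nu * #|T|%:R) by ring.
  by rewrite nuE mulr1.
apply: opnorm_sum_le; [by do 2?apply: mulr_ge0 | | exact: max_card].
(* Replacing X by X - F, which is O(nu), leaves the carre du champ at x unchanged; Q yields a second
   factor nu, so the sum over the volume is O(nu). *)
move=> x _; have [F cF hF] := liouvillian_pow_far x k hw.
rewrite -[gam _ _ _]subr0 -(carre_du_champ_farl Q cF) -carre_du_champBl.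
apply: le_trans (gam_pow_le_r x k' hw' hF) _.
by rewrite le_eqVlt; apply/orP; left; apply/eqP; rewrite /energy_const; ring.
Qed.

Lemma liouvillian_adj A : (Lv A) ^t* = Lv (A ^t*).
Proof.
rewrite /Lv adjmx_sum; apply: eq_bigr => x _; exact: lindblad_adj.
Qed.

Lemma total_pow_adj w k : (total w ^+ k) ^t* = total (fun y => (w y) ^t*) ^+ k.
Proof. by rewrite adjmxX /total adjmx_sum. Qed.

(** Z is controlled in norm, Y only through the state: omega(Y^* Y) may be small although the norm
    of Y is not. *)
Lemma state_cs_right Z Y u e : opnorm Z <= u ->
  normc (state_of rho (Y ^t* *m Y)) <= e ->
  normc (state_of rho (Z *m Y)) <= u * Num.sqrt e.
Proof.
move=> hZ hY.
have u0 : 0 <= u by apply: le_trans hZ; apply: opnorm_ge0.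
have e0 : 0 <= e by apply: le_trans hY; apply: normc_ge0.
apply: ler_sqrn; first by rewrite mulr_ge0 // sqrtr_ge0.
rewrite exprMn sqr_sqrtr // -[Z]trmxCK.
apply: le_trans (state_cauchy_schwarz rho_dm _ _) _.
apply: ler_pM => //; try exact: normc_ge0.
apply: le_trans (state_le_opnorm rho_dm _) _; rewrite trmxCK expr2.
exact: opnormM_le hZ (le_trans (opnorm_adj _) hZ).
Qed.

Lemma state_cs_left Z Y u e : opnorm Z <= u ->
  normc (state_of rho (Y *m Y ^t*)) <= e ->
  normc (state_of rho (Y *m Z)) <= u * Num.sqrt e.
Proof.
move=> hZ hY.
have u0 : 0 <= u by apply: le_trans hZ; apply: opnorm_ge0.
have e0 : 0 <= e by apply: le_trans hY; apply: normc_ge0.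
apply: ler_sqrn; first by rewrite mulr_ge0 // sqrtr_ge0.
rewrite exprMn sqr_sqrtr // mulrC -[X in X *m Z]trmxCK.
apply: le_trans (state_cauchy_schwarz rho_dm _ _) _.
rewrite trmxCK; apply: ler_pM => //; try exact: normc_ge0.
apply: le_trans (state_le_opnorm rho_dm _) _; rewrite expr2.
exact: opnormM_le (le_trans (opnorm_adj _) hZ) hZ.
Qed.

Definition local_at (p : pred T) A := forall x, ~~ p x -> cg x A.

(** At sites outside p the carre du champ vanishes, leaving at most m terms of order nu. *)
Lemma carre_du_champ_local_r w k A (p : pred T) m c : site_terms w ->
  local_at p A -> (#|p| <= m)%N -> opnorm A <= c ->
  opnorm (\sum_x gam x A (total w ^+ k)) <= m%:R * (3 * b * c * (diff_const k * nu)).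
Proof.
move=> hw Ap pm hA; have c0 : 0 <= c by apply: le_trans hA; apply: opnorm_ge0.
rewrite (bigID p) /= [X in _ + X]big1 ?addr0 => [|x /Ap]; last first.
  exact: carre_du_champ_farl.
apply: opnorm_sum_le pm => [|x _]; last exact: gam_pow_le_r.
by apply: mulr_ge0 (mulr_ge0 (diff_const_ge0 _) nu_ge0); do 2?apply: mulr_ge0.
Qed.

Lemma carre_du_champ_local_l w k A (p : pred T) m c : site_terms w ->
  local_at p A -> (#|p| <= m)%N -> opnorm A <= c ->
  opnorm (\sum_x gam x (total w ^+ k) A) <= m%:R * (3 * b * (diff_const k * nu) * c).
Proof.
move=> hw Ap pm hA; have c0 : 0 <= c by apply: le_trans hA; apply: opnorm_ge0.
rewrite (bigID p) /= [X in _ + X]big1 ?addr0 => [|x /Ap]; last first.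
  exact: carre_du_champ_farr.
apply: opnorm_sum_le pm => [|x _]; last exact: gam_pow_le_l.
apply: mulr_ge0 => //; apply: mulr_ge0 (mulr_ge0 (diff_const_ge0 _) nu_ge0).
exact: mulr_ge0.
Qed.

(** The summands bound, in this order, the contributions of P A B L[Q], of the carre du champ of B
    and Q, of L[P] A B Q, and of the carre du champ of P and A. *)
Definition reversal_const (k k' : nat) (m m' : nat) (c c' : R) : R :=
  a ^+ k' * c * c' * Num.sqrt (energy_const k k)
  + a ^+ k' * c * (m'%:R * (3 * b * c' * diff_const k))
  + c * c' * a ^+ k * Num.sqrt (energy_const k' k')
  + m%:R * (3 * b * diff_const k' * c) * (c' * a ^+ k).

Lemma state_reversal w w' k k' A B (p p' : pred T) m m' c c' :
  site_terms w -> site_terms w' ->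
  local_at p A -> (#|p| <= m)%N -> opnorm A <= c ->
  local_at p' B -> (#|p'| <= m')%N -> opnorm B <= c' ->
  nu <= 1 ->
  normc (state_of rho (total w' ^+ k' *m (Lv A *m B) *m total w ^+ k)
         - state_of rho (total w' ^+ k' *m (A *m Lv B) *m total w ^+ k))
  <= reversal_const k k' m m' c c' * Num.sqrt nu.
Proof.
move=> hw hw' Ap pm hA Bp pm' hB nu1.
set P := total w' ^+ k'; set Q := total w ^+ k.
have hP : opnorm P <= a ^+ k' by apply: opnormX_le; apply: total_le.
have hQ : opnorm Q <= a ^+ k by apply: opnormX_le; apply: total_le.
set G1 := \sum_x gam x B Q; set G2 := \sum_x gam x P A.
have hG1 := carre_du_champ_local_r k hw Bp pm' hB.
have hG2 := carre_du_champ_local_l k' hw' Ap pm hA.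
(* Reversibility for the pair P A, B Q, with both sides expanded by the Leibniz rule. *)
have key : state_of rho (P *m (Lv A *m B) *m Q) - state_of rho (P *m (A *m Lv B) *m Q)
  = state_of rho (P *m A *m B *m Lv Q) + state_of rho (P *m A *m G1)
    - state_of rho (Lv P *m (A *m B *m Q)) - state_of rho (G2 *m (B *m Q)).
  have rhs : state_of rho (P *m A *m Lv (B *m Q))
      = state_of rho (P *m (A *m Lv B) *m Q) + state_of rho (P *m A *m B *m Lv Q)
        + state_of rho (P *m A *m G1).
    by rewrite liouvillianM !mulmxDr !stateD !mulmxA.
  have lhs : state_of rho (Lv (P *m A) *m (B *m Q))
      = state_of rho (Lv P *m (A *m B *m Q)) + state_of rho (P *m (Lv A *m B) *m Q)
        + state_of rho (G2 *m (B *m Q)).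
    rewrite liouvillianM (mulmxDl (_ + _)) (mulmxDl (_ *m A)) !stateD -/G2.
    have h1 : Lv P *m A *m (B *m Q) = Lv P *m (A *m B *m Q).
      by rewrite -!mulmxA.
    have h2 : P *m Lv A *m (B *m Q) = P *m (Lv A *m B) *m Q.
      by rewrite -!mulmxA.
    by rewrite h1 h2.
  have := etrans (esym rhs) (etrans (rev (P *m A) (B *m Q)) lhs).
  move: (state_of rho (P *m (A *m Lv B) *m Q)) (state_of rho (P *m A *m B *m Lv Q))
    (state_of rho (P *m A *m G1)) (state_of rho (Lv P *m (A *m B *m Q)))
    (state_of rho (P *m (Lv A *m B) *m Q)) (state_of rho (G2 *m (B *m Q))).
  move=> s1 s2 s3 s4 s5 s6 e.
  have -> : s5 - s1 = (s4 + s5 + s6) - s1 - s4 - s6 by ring.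
  by rewrite -e; ring.
rewrite key.
(* As nu <= 1, the O(nu) terms are absorbed into the rate nu^(1/2). *)
have nus : nu <= Num.sqrt nu.
  have := sqr_sqrtr nu_ge0; have := sqrtr_ge0 nu; move: (Num.sqrt nu) => s s0 e.
  have s1 : s <= 1 by apply: ler_sqrn => //; rewrite e expr1n.
  by rewrite -e expr2 ler_piMr.
have T1 : normc (state_of rho (P *m A *m B *m Lv Q))
    <= a ^+ k' * c * c' * Num.sqrt (energy_const k k * nu).
  apply: state_cs_right; first exact: opnormM_le (opnormM_le hP hA) hB.
  (* The adjoint of Q is the same power of the adjoint site terms, so the energy bound covers L[Q]^*
     L[Q]. *)
  rewrite liouvillian_adj total_pow_adj.
  exact: liouvillian_pow_inner (site_terms_adj hw) hw.
have T3 : normc (state_of rho (Lv P *m (A *m B *m Q)))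
    <= c * c' * a ^+ k * Num.sqrt (energy_const k' k' * nu).
  apply: state_cs_left; first exact: opnormM_le (opnormM_le hA hB) hQ.
  rewrite liouvillian_adj total_pow_adj.
  exact: liouvillian_pow_inner hw' (site_terms_adj hw').
have T2 := le_trans (state_le_opnorm rho_dm _) (opnormM_le (opnormM_le hP hA) hG1).
have T4 := le_trans (state_le_opnorm rho_dm _) (opnormM_le hG2 (opnormM_le hB hQ)).
have c0 : 0 <= c by apply: le_trans hA; apply: opnorm_ge0.
have c'0 : 0 <= c' by apply: le_trans hB; apply: opnorm_ge0.
have ak0 l : 0 <= a ^+ l by apply: exprn_ge0.
have energy_ge0 l : 0 <= energy_const l l.
  apply: mulr_ge0 (diff_const_ge0 _); apply: mulr_ge0 (near_const_ge0 _).
  exact: mulr_ge0.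
rewrite sqrtrM // in T1; rewrite sqrtrM // in T3.
apply: le_trans (normc_leB _ _) _.
apply: le_trans (lerD (normc_leB _ _) (lexx _)) _.
apply: le_trans (lerD (lerD (normc_leD _ _) (lexx _)) (lexx _)) _.
rewrite /reversal_const.
rewrite !(mulrDl _ _ (Num.sqrt nu)).
apply: lerD; first apply: lerD; first apply: lerD.
- by rewrite -(mulrA _ _ (Num.sqrt nu)).
- apply: le_trans T2 _.
  have -> : a ^+ k' * c * (m'%:R * (3 * b * c' * (diff_const k * nu)))
          = a ^+ k' * c * (m'%:R * (3 * b * c' * diff_const k)) * nu by ring.
  apply: ler_wpM2l nus.
  have := diff_const_ge0 k; move: (diff_const k) => d d0.
  by rewrite !mulr_ge0.
- by rewrite -(mulrA _ _ (Num.sqrt nu)).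
- apply: le_trans T4 _.
  have -> : m%:R * (3 * b * (diff_const k' * nu) * c) * (c' * a ^+ k)
          = m%:R * (3 * b * diff_const k' * c) * (c' * a ^+ k) * nu by ring.
  apply: ler_wpM2l nus.
  have := diff_const_ge0 k'; move: (diff_const k') => d d0.
  by rewrite !mulr_ge0.
Qed.

End FiniteVolume.

(** * Lower bound on the normalizations *)

Section LowerBound.
Variable R : realType.

Lemma state_pow_le n (rho X : 'M[R[i]]_n) (a : R) k : density_matrix rho ->
  opnorm X <= a -> normc (state_of rho ((X ^t*) ^+ k *m X ^+ k)) <= a ^+ k * a ^+ k.
Proof.
move=> dm hX; apply: le_trans (state_le_opnorm dm _) _.
exact: opnormM_le (opnormX_le k (le_trans (opnorm_adj X) hX)) (opnormX_le k hX).
Qed.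

(** Cauchy-Schwarz for X^k and X^* X^(k+1). The squared norm of the latter is the moment k+2, up to
    replacing the middle X X^* by X^* X. *)
Lemma state_pow_log_convex n (rho X : 'M[R[i]]_n) (a e : R) k : density_matrix rho ->
  opnorm X <= a -> opnorm (X *m X ^t* - X ^t* *m X) <= e ->
  normc (state_of rho ((X ^t*) ^+ k.+1 *m X ^+ k.+1)) ^+ 2
  <= normc (state_of rho ((X ^t*) ^+ k *m X ^+ k))
     * (normc (state_of rho ((X ^t*) ^+ k.+2 *m X ^+ k.+2))
        + a ^+ k.+1 * e * a ^+ k.+1).
Proof.
move=> dm hX he.
set Y := X ^t* *m X ^+ k.+1.
have -> : (X ^t*) ^+ k.+1 *m X ^+ k.+1 = (X ^+ k) ^t* *m Y.
  by rewrite adjmxX /Y mulmxA; congr (_ *m _); apply: exprSr.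
apply: le_trans (state_cauchy_schwarz dm _ _) _.
rewrite [X in normc (state_of rho (X *m _)) * _]adjmxX.
apply: ler_wpM2l; first exact: normc_ge0.
have -> : Y ^t* *m Y = (X ^t*) ^+ k.+2 *m X ^+ k.+2
    + (X ^t*) ^+ k.+1 *m (X *m X ^t* - X ^t* *m X) *m X ^+ k.+1.
  have -> : (X ^t*) ^+ k.+2 = (X ^t*) ^+ k.+1 *m X ^t* by apply: exprSr.
  have -> : X ^+ k.+2 = X *m X ^+ k.+1 by apply: exprS.
  rewrite mulmxBr mulmxBl /Y adjmxM trmxCK adjmxX !mulmxA.
  by rewrite addrC subrK.
rewrite stateD; apply: le_trans (normc_leD _ _) _; rewrite lerD2l.
apply: le_trans (state_le_opnorm dm _) _.
exact: opnormM_le (opnormM_le (opnormX_le _ (le_trans (opnorm_adj X) hX)) he)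
  (opnormX_le _ hX).
Qed.

(* Log-convexity of the moments propagates the lower bound from k to k + 1. *)
Lemma state_pow_lower_bound (a beta : R) k : 1 <= a -> 0 < beta ->
  exists c eta : R, [/\ 0 < c, 0 < eta &
    forall n (rho X : 'M[R[i]]_n) e, density_matrix rho -> opnorm X <= a ->
      opnorm (X *m X ^t* - X ^t* *m X) <= e -> e <= eta ->
      beta <= normc (state_of rho (X ^t* *m X)) ->
      c <= normc (state_of rho ((X ^t*) ^+ k *m X ^+ k))].
Proof.
move=> a1 beta0; have a0 : 0 < a by apply: lt_le_trans a1.
elim: k => [|[|k] [c [eta [c0 eta0 IH]]]].
- exists 1, 1; split; rewrite ?ltr01 // => n rho X e dm _ _ _ _.
  by rewrite !expr0 mul1mx state1 // Normc.normc1.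
- by exists beta, 1; split.
have : 0 < a ^+ k * a ^+ k by rewrite mulr_gt0 // exprn_gt0.
move AE : (a ^+ k * a ^+ k) => A A0.
have : 0 < a ^+ k.+1 * a ^+ k.+1 by rewrite mulr_gt0 // exprn_gt0.
move BE : (a ^+ k.+1 * a ^+ k.+1) => B B0.
have c2 : 0 < c ^+ 2 by apply: exprn_gt0.
have A2 : 0 < 2 * A by rewrite mulr_gt0 // ltr0n.
(* Log-convexity gives c^2 <= A (z + B e) for the next moment z, and the choice of eta makes A B e
   at most c^2 / 2. *)
exists (c ^+ 2 / (2 * A)), (Num.min eta (c ^+ 2 / (2 * A * B))); split.
- exact: divr_gt0.
- by rewrite lt_min eta0 divr_gt0 // mulr_gt0.
move=> n rho X e dm hX he; rewrite le_min => /andP[e1 e2] hb.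
have h1 := IH n rho X e dm hX he e1 hb.
have h2 := state_pow_log_convex k dm hX he.
have h3 := state_pow_le k dm hX.
move: h1 h2 h3; rewrite AE.
have -> : a ^+ k.+1 * e * a ^+ k.+1 = B * e by rewrite -BE; ring.
have := normc_ge0 (state_of rho ((X ^t*) ^+ k.+2 *m X ^+ k.+2)).
move: (normc (state_of rho ((X ^t*) ^+ k.+2 *m X ^+ k.+2)))
  (normc (state_of rho ((X ^t*) ^+ k.+1 *m X ^+ k.+1)))
  (normc (state_of rho ((X ^t*) ^+ k *m X ^+ k))) => z2 z1 z0 z20 h1 h2 h3.
have e0 : 0 <= e by apply: le_trans he; apply: opnorm_ge0.
have cz : c ^+ 2 <= z1 ^+ 2 by rewrite ler_pXn2r // nnegrE ltW // (lt_le_trans c0).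
have h4 : c ^+ 2 <= A * (z2 + B * e).
  apply: le_trans cz _; apply: le_trans h2 _; apply: ler_wpM2r h3.
  by rewrite addr_ge0 // mulr_ge0 // ltW.
have h5 : A * (B * e) <= c ^+ 2 / 2.
  have : A * B * e <= A * B * (c ^+ 2 / (2 * A * B)) by rewrite ler_pM2l // mulr_gt0.
  rewrite -mulrA; move/le_trans; apply; rewrite le_eqVlt; apply/orP; left; apply/eqP.
  by field; rewrite !gt_eqF.
rewrite ler_pdivrMr //.
have -> : z2 * (2 * A) = 2 * (A * z2) by ring.
by move: h4 h5; rewrite mulrDr; lra.
Qed.

End LowerBound.

(** * Geometry of the torus *)

Section Torus.
Variable d : nat.

Lemma torus_dist_sym L (x y : torus d L) : torus_dist x y = torus_dist y x.
Proof. by apply: eq_bigr => k _; apply: minnC. Qed.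

Lemma torus_ball_sym L r (x y : torus d L) :
  (y \in torus_ball r x) = (x \in torus_ball r y).
Proof. by rewrite !inE torus_dist_sym. Qed.

Lemma torus_ball_center L r (x : torus d L) : x \in torus_ball r x.
Proof. by rewrite inE /torus_dist big1 // => k _; rewrite subrr minnn. Qed.

Lemma torus_ball_mono L r r' (x : torus d L) :
  (r <= r')%N -> torus_ball r x \subset torus_ball r' x.
Proof.
by move=> rr'; apply/fintype.subsetP => y; rewrite !inE => /leq_trans; apply.
Qed.

Definition ball_bound (r : nat) : nat := #|{ffun 'I_d -> bool * 'I_r.+1}|.

(* A point of the ball is determined by the signed, bounded offset of each of
   its coordinates. *)
Lemma torus_ball_card L r (x : torus d L) : (#|torus_ball r x| <= ball_bound r)%N.
Proof.
pose code (y : torus d L) : {ffun 'I_d -> bool * 'I_r.+1} :=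
  [ffun k => if (nat_of_ord (x k - y k)%R <= r)%N
             then (true, inord (nat_of_ord (x k - y k)%R))
             else (false, inord (nat_of_ord (y k - x k)%R))].
have code_inj : {in torus_ball r x &, injective code}.
  move=> y z; rewrite !inE => hy hz /ffunP e; apply/ffunP => k.
  have coord (u : torus d L) : (torus_dist x u <= r)%N ->
      (nat_of_ord (x k - u k)%R <= r)%N || (nat_of_ord (u k - x k)%R <= r)%N.
    rewrite /torus_dist (bigD1 k) //= => h; rewrite -geq_min.
    by apply: leq_trans h; apply: leq_addr.
  have cancel (b : bool) (m n : nat) : (m <= r)%N -> (n <= r)%N ->
      (b, inord m : 'I_r.+1) = (b, inord n) -> m = n.
    by move=> mr nr [] /(congr1 (@nat_of_ord _)); rewrite !inordK.
  have := e k; have := coord _ hy; have := coord _ hz; rewrite !ffunE.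
  case: ifP => h1; case: ifP => h2 h3 h4 //.
    by move/(cancel _ _ _ h1 h2)/ord_inj/addrI/oppr_inj.
  by move/(cancel _ _ _ h4 h3)/ord_inj/addIr.
rewrite -(card_in_imset code_inj) /ball_bound; exact: max_card.
Qed.

Definition overlap (r L : nat) : rel (torus d L) :=
  fun x y => [exists z, (z \in torus_ball r x) && (y \in torus_ball r z)].

Lemma overlap_refl r L : reflexive (@overlap r L).
Proof. by move=> x; apply/existsP; exists x; rewrite torus_ball_center. Qed.

Lemma overlap_sym r L : symmetric (@overlap r L).
Proof.
move=> x y; apply: eq_existsb => z.
by rewrite torus_ball_sym [in RHS]torus_ball_sym andbC.
Qed.

Lemma overlap_card r L (x : torus d L) :
  (#|overlap r x| <= ball_bound r * ball_bound r)%N.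
Proof.
apply: (@card_neighbours _ [in torus_ball r x] (fun z y => y \in torus_ball r z)).
  exact: torus_ball_card.
by move=> z; apply: torus_ball_card.
Qed.

Lemma overlap_disjoint r s s' L (x y : torus d L) :
  (s <= r)%N -> (s' <= r)%N -> ~~ overlap r x y ->
  [disjoint torus_ball s x & torus_ball s' y]%B.
Proof.
move=> sr s'r; apply: contraR => /pred0Pn[z /= /andP[zx zy]].
apply/existsP; exists z; rewrite (fintype.subsetP (torus_ball_mono x sr)) //=.
by rewrite torus_ball_sym (fintype.subsetP (torus_ball_mono y s'r)).
Qed.

Lemma card_torus L : #|torus d L| = (L.+1 ^ d)%N.
Proof. by rewrite card_ffun !card_ord. Qed.

Variables (R : realType) (q : nat).

Lemma supported_ball_comm r s s' L (x y : torus d L) (A B : op R q (torus d L)) :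
  (s <= r)%N -> (s' <= r)%N -> ~~ overlap r x y ->
  supported (torus_ball s x) A -> supported (torus_ball s' y) B ->
  A *m B = B *m A.
Proof.
by move=> sr s'r nxy hA hB; apply: supported_comm hA hB _; apply: overlap_disjoint nxy.
Qed.

(** The sites whose generators need not commute with an operator localized on X; their number is
    bounded independently of L. *)
Definition meets_image (r L : nat) (X : {fset {ffun 'I_d -> int}}) : pred (torus d L) :=
  [pred x | [exists z, (z \in codom (fun u : X => torus_proj L (val u)))
                       && (x \in torus_ball r z)]].

Lemma meets_image_card r L (X : {fset {ffun 'I_d -> int}}) :
  (#|@meets_image r L X| <= #|{: X}| * ball_bound r)%N.
Proof.
apply: (@card_neighbours _ [in codom (fun u : X => torus_proj L (val u))]
          (fun z y => y \in torus_ball r z)).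
  exact: leq_image_card.
by move=> z; apply: torus_ball_card.
Qed.

Lemma local_op_comm r s L (X : {fset {ffun 'I_d -> int}}) (a : op R q X)
    (x : torus d L) (A : op R q (torus d L)) :
  (s <= r)%N -> ~~ @meets_image r L X x -> supported (torus_ball s x) A ->
  A *m local_op a L = local_op a L *m A.
Proof.
move=> sr nx [h ->]; apply: embed_comm; apply/pred0P => z /=.
apply/negP => /andP[/codomP[u zu] zX]; case/negP: nx; apply/existsP; exists z.
rewrite zX torus_ball_sym (fintype.subsetP (torus_ball_mono x sr)) // zu.
exact: (valP u).
Qed.

Lemma local_op_opnorm L (X : {fset {ffun 'I_d -> int}}) (a : op R q X) :
  opnorm (local_op a L) <= abs_sum a.
Proof. exact: embed_opnorm. Qed.

End Torus.

(** * The infinite-volume limit *)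

Section Asymptotics.
Variables (R : realType) (s : nat -> R).
Hypothesis s_ge0 : forall L, 0 <= s L.
Hypothesis s_cvg0 : forall eps : R, 0 < eps -> \forall L \near \oo, s L < eps.

Definition big_oh (f : nat -> R[i]) : Prop :=
  exists2 c : R, 0 <= c & \forall L \near \oo, normc (f L) <= c * s L.

Lemma big_oh_sum (I : finType) (f : I -> nat -> R[i]) :
  (forall i, big_oh (f i)) -> big_oh (fun L => \sum_i f i L).
Proof.
move=> h.
suff seqs (r : seq I) : big_oh (fun L => \sum_(i <- r) f i L) by apply: seqs.
elim: r => [|i r [c c0 hc]].
  by exists 0 => //; near=> L; rewrite big_nil Normc.normc0 mul0r.
have [c' c'0 hc'] := h i; exists (c' + c); first exact: addr_ge0.
near=> L; rewrite big_cons; apply: le_trans (normc_leD _ _) _.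
by rewrite mulrDl lerD //; near: L.
Unshelve. all: by end_near.
Qed.

Lemma big_oh_scale (k : R[i]) f : big_oh f -> big_oh (fun L => k * f L).
Proof.
move=> [c c0 hc]; exists (normc k * c); first by rewrite mulr_ge0 ?normc_ge0.
near=> L; rewrite Normc.normcM -mulrA ler_wpM2l ?normc_ge0 //; near: L.
exact: hc.
Unshelve. all: by end_near.
Qed.

Lemma big_oh_cvg0 f : big_oh f -> (fun L => normc (f L)) @ \oo --> (0 : R).
Proof.
move=> [c c0 hc]; apply/cvgrPdist_lt => eps eps0.
near=> L; rewrite sub0r normrN ger0_norm ?normc_ge0 //.
have h1 : normc (f L) <= c * s L by near: L.
apply: le_lt_trans h1 _.
(* c may vanish, hence the division by c + 1. *)
have h2 : s L < eps / (c + 1).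
  by near: L; apply: s_cvg0; rewrite divr_gt0 // ltr_wpDl.
apply: (@le_lt_trans _ _ ((c + 1) * s L)).
  by rewrite ler_wpM2r // lerDl.
by rewrite mulrC -ltr_pdivlMr // ltr_wpDl.
Unshelve. all: by end_near.
Qed.

End Asymptotics.

(** * The operators O^+ and O^- *)

Section OrderParameters.
Variables (R : realType) (n : nat).

(* The sign s selects O^+ (true) or O^- (false). *)
Definition sgni (s : bool) : R[i] := if s then 'i%R else - 'i%R.

Definition Osign (s : bool) (O1 O2 : 'M[R[i]]_n) : 'M[R[i]]_n := O1 + sgni s *: O2.

Lemma normc_sgni s : normc (sgni s) = 1.
Proof. by case: s; rewrite /sgni ?normc_opp normci. Qed.

Lemma conj_sgni s : Num.conj (sgni s) = sgni (~~ s).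
Proof. by case: s; rewrite /sgni ?rmorphN /= conjCi ?opprK. Qed.

(** The convention for negative powers becomes a natural power of the operator selected by the sign
    of k. *)
Lemma Oplus_powE (O1 O2 : 'M[R[i]]_n) (k : int) :
  Oplus_pow O1 O2 k = Osign (0 <= k) O1 O2 ^+ `|k|%N.
Proof.
by case: k => m; rewrite /Oplus_pow /= /Osign /sgni /= ?scaleNr.
Qed.

Lemma Ominus_powE (O1 O2 : 'M[R[i]]_n) (k : int) :
  Ominus_pow O1 O2 k = Osign (~~ (0 <= k)) O1 O2 ^+ `|k|%N.
Proof.
by case: k => m; rewrite /Ominus_pow /= /Osign /sgni /= ?scaleNr.
Qed.

Lemma Osign_adj s (O1 O2 : 'M[R[i]]_n) : O1 \is hermsymmx -> O2 \is hermsymmx ->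
  (Osign s O1 O2) ^t* = Osign (~~ s) O1 O2.
Proof.
move=> /is_hermitianmxP h1 /is_hermitianmxP h2.
rewrite expr0 scale1r in h1; rewrite expr0 scale1r in h2.
by rewrite /Osign adjmxD adjmxZ conj_sgni -h1 -h2.
Qed.

End OrderParameters.

(** z stands for i or -i. The cross terms of the two products are opposite, so only squares
    remain. *)
Lemma Osign_anticomm (C : numClosedFieldType) n (O1 O2 : 'M[C]_n) (z c : C) :
  z ^+ 2 = -1 ->
  (c *: (O1 - z *: O2)) *m (c *: (O1 + z *: O2))
    + (c *: (O1 + z *: O2)) *m (c *: (O1 - z *: O2))
  = (2 * c ^+ 2) *: (O1 ^+ 2 + O2 ^+ 2).
Proof.
move=> z2; rewrite -!scalemxAl -!scalemxAr.
rewrite !(mulmxDl, mulmxDr, mulmxN, mulNmx) -!(scalemxAl, scalemxAr).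
have -> : O1 ^+ 2 = O1 *m O1 by apply: expr2.
have -> : O2 ^+ 2 = O2 *m O2 by apply: expr2.
rewrite [z *: (z *: _)]scalerA -expr2 z2.
mx_linear ltac:(ring).
Qed.

(** Only overlapping pairs contribute, at most D for each x, and each is bounded by 2 c^2. For c =
    O(nu) the commutator is thus O(nu). *)
Lemma extensive_commutator_le (R : realType) n (T : finType) (ov : rel T) (D : nat)
    (w w' : T -> 'M[R[i]]_n) (c : R) :
  (forall x, #|ov x| <= D)%N -> 0 <= c ->
  (forall x, opnorm (w x) <= c) -> (forall x, opnorm (w' x) <= c) ->
  (forall x y, ~~ ov x y -> w x *m w' y = w' y *m w x) ->
  opnorm ((\sum_x w x) *m (\sum_y w' y) - (\sum_y w' y) *m (\sum_x w x))
  <= #|T|%:R * (D%:R * (c * c + c * c)).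
Proof.
move=> hD c0 hw hw' hc.
have -> : (\sum_x w x) *m (\sum_y w' y) - (\sum_y w' y) *m (\sum_x w x)
        = \sum_x \sum_(y | ov x y) (w x *m w' y - w' y *m w x).
  rewrite mulmx_suml mulmx_sumr -sumrB; apply: eq_bigr => x _.
  rewrite mulmx_sumr mulmx_suml -sumrB (bigID (ov x)) /= [X in _ + X]big1 ?addr0 //.
  by move=> y /hc ->; rewrite subrr.
have cc0 : 0 <= c * c + c * c by rewrite addr_ge0 ?mulr_ge0.
apply: opnorm_sum_le; [by rewrite mulr_ge0 | | exact: max_card].
move=> x _; apply: opnorm_sum_le (hD x) => // y _.
apply: le_trans (opnormB _ _) _.
exact: lerD (opnormM_le (hw x) (hw' y)) (opnormM_le (hw' y) (hw x)).
Qed.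

Lemma scalemxX (R : realType) n (c : R[i]) (A : 'M[R[i]]_n) k :
  (c *: A) ^+ k = c ^+ k *: A ^+ k.
Proof.
elim: k => [|k IH]; first by rewrite !expr0 scale1r.
rewrite !mx_exprS IH -scalemxAl -scalemxAr scalerA.
by congr (_ *: _); rewrite exprS.
Qed.

(** * Uniform estimates along the sequence of cubes *)

Section Cubes.
Variables (R : realType) (d q : nat).
Hypothesis d_gt0 : (0 < d)%N.
Variables (H : forall L, torus d L -> op R q (torus d L))
  (Ls : forall L, torus d L -> seq (op R q (torus d L)))
  (rho O1 O2 : forall L, op R q (torus d L)) (o mu b : R) (r r1 r2 : nat)
  (O1loc O2loc : forall L, torus d L -> op R q (torus d L)).
Hypothesis H_herm : forall L (x : torus d L), H x \is hermsymmx.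
Hypothesis gens_supp : forall L (x : torus d L),
  supported (torus_ball r x) (H x) /\
  (forall K, K \in Ls x -> supported (torus_ball r x) K).
Hypothesis b_gt0 : 0 < b.
Hypothesis term_bound : forall L (x : torus d L) (A : op R q (torus d L)),
  opnorm (lindblad_term (H x) (Ls x) A) <= b * opnorm A.
Hypothesis rho_dm : forall L, density_matrix (rho L).
Hypothesis rev : forall L, reversible (rho L) (liouvillian (@H L) (@Ls L)).
Hypothesis O1_herm : forall L, O1 L \is hermsymmx.
Hypothesis O2_herm : forall L, O2 L \is hermsymmx.
Hypothesis o_gt0 : 0 < o.
Hypothesis mu_gt0 : 0 < mu.
Hypothesis O1_sum : forall L, O1 L = \sum_x O1loc x.
Hypothesis O2_sum : forall L, O2 L = \sum_x O2loc x.
Hypothesis O1loc_supp : forall L (x : torus d L),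
  supported (torus_ball r1 x) (O1loc x) /\ opnorm (O1loc x) <= o.
Hypothesis O2loc_supp : forall L (x : torus d L),
  supported (torus_ball r2 x) (O2loc x) /\ opnorm (O2loc x) <= o.
Hypothesis O12 : forall L,
  state_of (rho L) (O1 L ^+ 2) = state_of (rho L) (O2 L ^+ 2).
Hypothesis LRO : forall L,
  ((mu * o * #|torus d L|%:R) ^+ 2)%:C <= state_of (rho L) (O1 L ^+ 2).

Let rr := maxn r (maxn r1 r2).
(** 2 o bounds a site term of O^+ or O^-; the added 1 ensures a >= 1. *)
Let a : R := 2 * o + 1.
Let nu L : R := (#|torus d L|%:R)^-1.
Let D := (ball_bound d rr * ball_bound d rr)%N.
Let Lv L := liouvillian (@H L) (@Ls L).

Let a_ge1 : 1 <= a. Proof. by rewrite /a lerDr mulr_ge0 // ltW. Qed.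

Let vol_gt0 L : 0 < #|torus d L|%:R :> R.
Proof. by rewrite ltr0n card_torus expn_gt0. Qed.

Let nu_gt0 L : 0 < nu L. Proof. by rewrite invr_gt0. Qed.

Let nuE L : nu L * #|torus d L|%:R = 1.
Proof. by rewrite mulVf // gt_eqF. Qed.

Let nu_le L : nu L <= L.+1%:R^-1.
Proof.
rewrite /nu lef_pV2 ?posrE ?ltr0n ?card_torus ?expn_gt0 // ler_nat.
by rewrite -{1}(expn1 L.+1) leq_pexp2l.
Qed.

Let nu_le1 L : nu L <= 1.
Proof. by apply: le_trans (nu_le L) _; rewrite invf_le1 ?ltr0n // ler1n. Qed.

Lemma inv_volume_cvg0 eps : 0 < eps -> \forall L \near \oo, nu L < eps.
Proof.
move=> eps0; have := near_infty_natSinv_lt (PosNum eps0).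
by apply: filterS => L; apply: le_lt_trans (nu_le L).
Qed.

Let w (s : bool) L (y : torus d L) : op R q (torus d L) :=
  (nu L)%:C *: (O1loc y + sgni R s *: O2loc y).

Let normc_nu L : normc (nu L)%:C = nu L.
Proof. by rewrite normc_real // ltW. Qed.

Let total_w s L : \sum_y w s y = (nu L)%:C *: Osign s (O1 L) (O2 L).
Proof.
by rewrite -scaler_sumr big_split /= -scaler_sumr O1_sum O2_sum.
Qed.

Let w_le s L (y : torus d L) : opnorm (w s y) <= a * nu L.
Proof.
apply: le_trans (opnormZ_le _ _) _; rewrite normc_nu mulrC.
apply: ler_wpM2r; first exact: ltW.
apply: le_trans (opnormD _ _) _.
have h1 := (O1loc_supp y).2; have h2 := (O2loc_supp y).2.
have h3 := opnormZ_le (sgni R s) (O2loc y); rewrite normc_sgni mul1r in h3.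
apply: le_trans (lerD h1 (le_trans h3 h2)) _.
by rewrite /a mulr_natl mulr2n lerDl ler01.
Qed.

Let r_le : (r <= rr)%N. Proof. exact: leq_maxl. Qed.
Let r1_le : (r1 <= rr)%N. Proof. by rewrite !leq_max leqnn orbT. Qed.
Let r2_le : (r2 <= rr)%N. Proof. by rewrite !leq_max leqnn !orbT. Qed.

Lemma commutes_gens_supported s L (x y : torus d L) (A : op R q (torus d L)) :
  (s <= rr)%N -> ~~ overlap rr x y -> supported (torus_ball s y) A ->
  commutes_gens (H x) (Ls x) A.
Proof.
move=> srr nxy hA; have [hH hL] := gens_supp x.
split; first exact: supported_ball_comm r_le srr nxy hH hA.
move=> K /hL hK; split; first exact: supported_ball_comm r_le srr nxy hK hA.
exact: supported_ball_comm r_le srr nxy (supported_adj hK) hA.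
Qed.

Let gens_far L (x y : torus d L) : ~~ overlap rr x y ->
  commutes_gens (H y) (Ls y) (H x) /\
  forall K, K \in Ls x ->
    commutes_gens (H y) (Ls y) K /\ commutes_gens (H y) (Ls y) (K ^t*).
Proof.
rewrite overlap_sym => nyx; have [hH hL] := gens_supp x.
split; first exact: commutes_gens_supported r_le nyx hH.
move=> K /hL hK; split; first exact: commutes_gens_supported r_le nyx hK.
exact: commutes_gens_supported r_le nyx (supported_adj hK).
Qed.

Let w_site s L : site_terms (@H L) (@Ls L) (@overlap d rr L) a (nu L) (@w s L).
Proof.
split=> [y|x y nxy]; first exact: w_le.
apply: commutes_gensZ; apply: commutes_gensD.
  exact: commutes_gens_supported r1_le nxy (O1loc_supp y).1.
by apply/commutes_gensZ/(commutes_gens_supported r2_le nxy (O2loc_supp y).1).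
Qed.

Let w_comm s s' L (x y : torus d L) : ~~ overlap rr x y ->
  w s x *m w s' y = w s' y *m w s x.
Proof.
move=> nxy; rewrite /w -!scalemxAl -!scalemxAr.
congr (_ *: (_ *: _)).
have h11 := supported_ball_comm r1_le r1_le nxy (O1loc_supp x).1 (O1loc_supp y).1.
have h12 := supported_ball_comm r1_le r2_le nxy (O1loc_supp x).1 (O2loc_supp y).1.
have h21 := supported_ball_comm r2_le r1_le nxy (O2loc_supp x).1 (O1loc_supp y).1.
have h22 := supported_ball_comm r2_le r2_le nxy (O2loc_supp x).1 (O2loc_supp y).1.
rewrite !mulmxDl !mulmxDr -!scalemxAl -!scalemxAr h11 h12 h21 h22.
rewrite !scalerA (mulrC (sgni R s')).
by rewrite addrACA.
Qed.

(* O^+ or O^- per unit volume. *)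
Let X s L : op R q (torus d L) := (nu L)%:C *: Osign s (O1 L) (O2 L).

Let X_adj s L : (X s L) ^t* = X (~~ s) L.
Proof.
rewrite /X adjmxZ (Osign_adj s (O1_herm L) (O2_herm L)); congr (_ *: _).
by apply: geC0_conj; rewrite ler0c ltW.
Qed.

Let X_le s L : opnorm (X s L) <= a.
Proof.
rewrite /X -total_w; apply: (@le_trans _ _ (#|torus d L|%:R * (a * nu L))).
  apply: opnorm_sum_le => [|y _|]; [|exact: w_le|exact: max_card].
  by rewrite mulr_ge0 ?(ltW (nu_gt0 L)) // (le_trans ler01).
by rewrite mulrC -mulrA nuE mulr1.
Qed.

Let comm_const : R := D%:R * (a * a + a * a).

Let X_comm s L :
  opnorm (X s L *m (X s L) ^t* - (X s L) ^t* *m X s L) <= comm_const * nu L.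
Proof.
rewrite X_adj /X -!total_w.
have c0 : 0 <= a * nu L by rewrite mulr_ge0 ?(ltW (nu_gt0 L)) // (le_trans ler01).
apply: le_trans (extensive_commutator_le (@overlap_card d rr L) c0
  (@w_le s L) (@w_le (~~ s) L) (@w_comm s (~~ s) L)) _.
rewrite -/D le_eqVlt; apply/orP; left; apply/eqP.
have -> : #|torus d L|%:R * (D%:R * (a * nu L * (a * nu L) + a * nu L * (a * nu L)))
  = comm_const * nu L * (nu L * #|torus d L|%:R) by rewrite /comm_const; ring.
by rewrite nuE mulr1.
Qed.

Let X_anticomm s L : (X s L) ^t* *m X s L + X s L *m (X s L) ^t*
  = (2 * (nu L)%:C ^+ 2) *: (O1 L ^+ 2 + O2 L ^+ 2).
Proof.
rewrite X_adj /X.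
have sgn2 : sgni R s ^+ 2 = -1 by case: s; rewrite /sgni ?sqrrN sqrCi.
have -> : Osign (~~ s) (O1 L) (O2 L) = O1 L - sgni R s *: O2 L.
  by case: s {sgn2}; rewrite /Osign /sgni /= ?scaleNr ?opprK.
exact: Osign_anticomm.
Qed.

(** With P = X^* X and Q = X X^*, long-range order makes |omega(P + Q)| at least 4 (mu o)^2, while
    |omega(Q - P)| is at most 2 (mu o)^2; and 2 P = (P + Q) - (Q - P). *)
Let X_moment s L : comm_const * nu L <= 2 * (mu * o) ^+ 2 ->
  (mu * o) ^+ 2 <= normc (state_of (rho L) ((X s L) ^t* *m X s L)).
Proof.
move=> small.
set P := (X s L) ^t* *m X s L; set Q := X s L *m (X s L) ^t*.
have hQP := X_comm s L; rewrite -/P -/Q in hQP.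
have key : 2 * state_of (rho L) P + state_of (rho L) (Q - P)
  = 2 * 2 * (nu L)%:C ^+ 2 * state_of (rho L) (O1 L ^+ 2).
  have -> : 2 * state_of (rho L) P + state_of (rho L) (Q - P)
          = state_of (rho L) (P + Q) by rewrite stateB stateD; ring.
  by rewrite X_anticomm stateZ stateD -O12; ring.
have h1 := normc_ge_real (LRO L).
have h2 : 4 * (mu * o) ^+ 2
    <= normc (2 * 2 * (nu L)%:C ^+ 2 * state_of (rho L) (O1 L ^+ 2)).
  rewrite 3!Normc.normcM normcX !normc_nat normc_nu.
  apply: (@le_trans _ _ (2 * 2 * nu L ^+ 2 * (mu * o * #|torus d L|%:R) ^+ 2)).
    have -> : 2 * 2 * nu L ^+ 2 * (mu * o * #|torus d L|%:R) ^+ 2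
      = 4 * (mu * o) ^+ 2 * (nu L * #|torus d L|%:R) ^+ 2 by ring.
    by rewrite nuE expr1n [leRHS]mulr1.
  apply: ler_wpM2l h1; apply: mulr_ge0 (sqr_ge0 _).
  by rewrite mulr_ge0 ?ler0n.
rewrite -key in h2.
have h3 := le_trans h2 (normc_leD _ _).
rewrite Normc.normcM normc_nat in h3.
have h4 := le_trans (state_le_opnorm (rho_dm L) (Q - P)) hQP.
move: h3 h4 small; move: (normc _) (normc _) (comm_const * nu L) ((mu * o) ^+ 2).
by move=> u v e m; lra.
Qed.

Lemma moment_lower_bound k : exists2 c : R, 0 < c &
  \forall L \near \oo, forall s,
    c <= normc (state_of (rho L) (((X s L) ^t*) ^+ k *m X s L ^+ k)).
Proof.
have beta0 : 0 < (mu * o) ^+ 2 by rewrite exprn_gt0 // mulr_gt0.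
have [c [eta [c0 eta0 h]]] := state_pow_lower_bound k a_ge1 beta0.
exists c => //.
have cc0 : 0 <= comm_const.
  by rewrite mulr_ge0 // addr_ge0 // mulr_ge0 // (le_trans ler01).
have c1 : 0 < comm_const + 1 by rewrite ltr_wpDl.
have := inv_volume_cvg0 (divr_gt0 eta0 c1).
have := inv_volume_cvg0 (divr_gt0 beta0 c1).
apply: filterS2 => L h1 h2 s.
have small e : 0 < e -> nu L < e / (comm_const + 1) -> comm_const * nu L <= e.
  move=> e0; rewrite ltr_pdivlMr // => /ltW; apply: le_trans.
  by rewrite mulrC ler_wpM2l ?(ltW (nu_gt0 L)) // lerDl.
apply: h (rho_dm L) (X_le s L) (X_comm s L) (small _ eta0 h2) (X_moment s _).
apply: le_trans (small _ beta0 h1) _.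
by rewrite ler_peMl ?(ltW beta0) // ler1n.
Qed.

Let Zn L k := Znorm (rho L) (O1 L) (O2 L) k.

Let Zn_sqr L (k : int) :
  normc ((nu L)%:C ^+ `|k|%N * Zn L k) ^+ 2
  = normc (state_of (rho L)
      (((X (0 <= k) L) ^t*) ^+ `|k|%N *m X (0 <= k) L ^+ `|k|%N)).
Proof.
rewrite -normcX exprMn sqrtCK Ominus_powE Oplus_powE X_adj /X !scalemxX.
by rewrite -scalemxAl -scalemxAr scalerA stateZ -expr2.
Qed.

Lemma Znorm_lower_bound (k : int) : exists2 c : R, 0 < c &
  \forall L \near \oo, c <= normc ((nu L)%:C ^+ `|k|%N * Zn L k).
Proof.
have [c c0 hc] := moment_lower_bound `|k|%N.
exists (Num.sqrt c); first by rewrite sqrtr_gt0.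
move: hc; apply: filterS => L /(_ (0 <= k)); rewrite -Zn_sqr => h.
by apply: ler_sqrn; rewrite ?normc_ge0 // sqr_sqrtr // ltW.
Qed.

(** Each k has its own threshold for L; the induction on M intersects finitely many eventual
    statements. *)
Lemma Znorm_neq0 M : \forall L \near \oo, forall k : int,
  (`|k| <= M)%N -> Zn L k != 0.
Proof.
have one (k : int) : \forall L \near \oo, Zn L k != 0.
  have [c c0 hc] := Znorm_lower_bound k; move: hc; apply: filterS => L.
  move=> h; apply/eqP => e; move: h; rewrite e mulr0 Normc.normc0.
  by rewrite leNgt c0.
elim: M => [|M IH].
  have := one 0; apply: filterS => L h k; rewrite leqn0 absz_eq0 => /eqP ->.
  exact: h.
move: IH (one M.+1%:Z) (one (- M.+1%:Z)).
apply: filterS3 => L h h1 h2 k.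
rewrite leq_eqVlt => /orP[/eqP kM|]; last exact: h.
have [->|->] : k = M.+1%:Z \/ k = - M.+1%:Z.
  by case: k kM => m /= mM; [left; rewrite mM | right; rewrite NegzE mM].
- exact: h1.
- exact: h2.
Qed.

(** Rescaling the powers of O^+ and O^- by the volume cancels against rescaling Z(k) Z(k'), whose
    rescaled value stays away from zero. *)
Lemma chi_reversal (k k' : int) (Sa Sb : {fset {ffun 'I_d -> int}})
    (Aop : op R q Sa) (Bop : op R q Sb) :
  big_oh (fun L => Num.sqrt (nu L)) (fun L =>
    chi (rho L) (O1 L) (O2 L) k k' (Lv (local_op Aop L) *m local_op Bop L)
    - chi (rho L) (O1 L) (O2 L) k k' (local_op Aop L *m Lv (local_op Bop L))).
Proof.
have [c c0 hc] := Znorm_lower_bound k; have [c' c'0 hc'] := Znorm_lower_bound k'.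
(* The left factor is a power of O^-, hence the negation in [s']. *)
set m := `|k|%N; set m' := `|k'|%N; set s := 0 <= k; set s' := ~~ (0 <= k').
pose na := (#|{: Sa}| * ball_bound d rr)%N.
pose nb := (#|{: Sb}| * ball_bound d rr)%N.
(* The absolute value makes the constant visibly nonnegative. *)
pose C := `|reversal_const D a b m m' na nb (abs_sum Aop) (abs_sum Bop)|.
exists (C / (c * c')); first by rewrite divr_ge0 ?normr_ge0 // mulr_ge0 // ltW.
move: hc hc'; apply: filterS2 => L hz hz'.
have loc (S : {fset {ffun 'I_d -> int}}) (A : op R q S) :
    local_at (@H L) (@Ls L) (@meets_image d rr L S) (local_op A L).
  move=> x nx; have [hH hL] := gens_supp x.
  split; first exact: local_op_comm r_le nx hH.
  move=> K /hL hK; split; first exact: local_op_comm r_le nx hK.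
  exact: local_op_comm r_le nx (supported_adj hK).
have main := state_reversal (@H_herm L) (ltW b_gt0) (@term_bound L) (rho_dm L)
  (@rev L) (@overlap_refl d rr L) (@overlap_sym d rr L) (@overlap_card d rr L)
  (@gens_far L) a_ge1 (nuE L) (ltW (nu_gt0 L)) m m'
  (w_site s L) (w_site s' L) (loc _ Aop) (@meets_image_card d rr L Sa)
  (local_op_opnorm L Aop) (loc _ Bop) (@meets_image_card d rr L Sb)
  (local_op_opnorm L Bop) (nu_le1 L).
rewrite !total_w in main.
have scaled Y : state_of (rho L)
    (((nu L)%:C *: Osign s' (O1 L) (O2 L)) ^+ m' *m Y
     *m ((nu L)%:C *: Osign s (O1 L) (O2 L)) ^+ m)
  = ((nu L)%:C ^+ m * Zn L k) * ((nu L)%:C ^+ m' * Zn L k')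
    * chi (rho L) (O1 L) (O2 L) k k' Y.
  have nz (z : R[i]) (e : R) : 0 < e -> e <= normc z -> z != 0.
    move=> e0 h; apply/eqP => z0; move: h.
    by rewrite z0 Normc.normc0 leNgt e0.
  have := nz _ _ c0 hz; have := nz _ _ c'0 hz'.
  rewrite !mulf_eq0 !negb_or => /andP[_ z'0] /andP[_ z0].
  rewrite !scalemxX -!scalemxAl -scalemxAr scalerA stateZ /chi.
  rewrite Oplus_powE Ominus_powE -/m -/m' -/s -/s' -/(Zn L k) -/(Zn L k').
  move: (state_of _ _) => S; move: (Zn L k) (Zn L k') z0 z'0 => z z' z0 z'0.
  by field; rewrite z0 z'0.
rewrite !scaled -mulrBr !Normc.normcM -!Normc.normcM in main.
rewrite Normc.normcM (Normc.normcM ((nu L)%:C ^+ m * Zn L k)) in main.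
rewrite mulrAC ler_pdivlMr; last exact: mulr_gt0.
have h : reversal_const D a b m m' na nb (abs_sum Aop) (abs_sum Bop) * Num.sqrt (nu L)
    <= C * Num.sqrt (nu L).
  by apply: ler_wpM2r; [exact: sqrtr_ge0 | exact: ler_norm].
apply: le_trans (le_trans main h); rewrite mulrC.
apply: ler_wpM2r; first exact: normc_ge0.
by apply: ler_pM => //; apply: ltW.
Qed.

Lemma omegaM_asymptotically_reversible M :
  asymptotically_reversible (@Lv) (fun L => omegaM (rho L) (O1 L) (O2 L) M).
Proof.
move=> Sa Sb Aop Bop.
apply: (@big_oh_cvg0 _ (fun L => Num.sqrt (nu L))).
- by move=> L; apply: sqrtr_ge0.
- move=> eps eps0; have := inv_volume_cvg0 (exprn_gt0 2 eps0).
  apply: filterS => L h; rewrite -(ger0_norm (ltW eps0)) -sqrtr_sqr.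
  by rewrite ltr_sqrt // exprn_gt0.
have sums : big_oh (fun L => Num.sqrt (nu L)) (fun L =>
    \sum_(i < M.*2.+1) \sum_(j < M.*2.+1)
      (chi (rho L) (O1 L) (O2 L) (i%:Z - M%:Z) (j%:Z - M%:Z)
         (Lv (local_op Aop L) *m local_op Bop L)
       - chi (rho L) (O1 L) (O2 L) (i%:Z - M%:Z) (j%:Z - M%:Z)
         (local_op Aop L *m Lv (local_op Bop L)))).
  by apply: big_oh_sum => i; apply: big_oh_sum => j; apply: chi_reversal.
have [c c0 hc] := big_oh_scale (M.*2.+1%:R)^-1 sums.
exists c => //; move: hc; apply: filterS => L.
congr (normc _ <= _); rewrite /omegaM -mulrBr; congr (_ * _).
by rewrite -sumrB; apply: eq_bigr => i _; rewrite -sumrB.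
Qed.

(** Asymptotic reversibility with B = 1, since L[1] = 0. *)
Lemma omegaM_metastable M :
  metastable (@Lv) (fun L => omegaM (rho L) (O1 L) (O2 L) M).
Proof.
move=> Sa Aop.
have := omegaM_asymptotically_reversible M Aop (1%:M : op R q Sa).
apply: cvg_trans; apply: near_eq_cvg; near=> L.
have -> : local_op (1%:M : op R q Sa) L = 1%:M by apply: embed1.
have -> : Lv (1%:M) = 0 :> op R q (torus d L).
  by rewrite /Lv /liouvillian big1 // => x _; rewrite lindblad_termE lindblad1.
rewrite mulmx1 mulmx0; congr normc.
rewrite (_ : omegaM _ _ _ _ 0 = 0) ?subr0 //.
rewrite /omegaM big1 ?mulr0 // => i _; rewrite big1 // => j _.
by rewrite /chi mulmx0 mul0mx /state_of mulmx0 mxtrace0 mul0r.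
Unshelve. all: by end_near.
Qed.

End Cubes.

(** The first conjunct rules out the default value of division by zero: for large cubes the
    quotients in [chi] have nonzero denominators. *)
Theorem theorem4 (R : realType) (d q : nat) (hd : (0 < d)%N) (hq : (0 < q)%N)
    (H : forall L, torus d L -> op R q (torus d L))
    (Ls : forall L, torus d L -> seq (op R q (torus d L)))
    (rho C O1 O2 : forall L, op R q (torus d L))
    (o mu : R)
    (hH : forall L (x : torus d L), H L x \is hermsymmx)
    (hloc : strictly_local H Ls)
    (hbd : uniformly_bounded H Ls)
    (hrho : forall L, density_matrix (rho L))
    (hrev : forall L, reversible (rho L) (liouvillian (H L) (Ls L)))
    (hCsa : forall L, C L \is hermsymmx)
    (hO1sa : forall L, O1 L \is hermsymmx)
    (hO2sa : forall L, O2 L \is hermsymmx)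
    (hC : exists c : R, extensive c C)
    (ho : 0 < o)
    (hO1 : extensive o O1)
    (hO2 : extensive o O2)
    (hCO1 : forall L, commutator (C L) (O1 L) = 'i *: O2 L)
    (hCO2 : forall L, commutator (C L) (O2 L) = - 'i *: O1 L)
    (hrhoC : forall L, commutator (rho L) (C L) = 0)
    (hmu : 0 < mu <= 1)
    (hO12 : forall L,
       state_of (rho L) (O1 L ^+ 2) = state_of (rho L) (O2 L ^+ 2))
    (hLRO : forall L,
       ((mu * o * #|torus d L|%:R) ^+ 2)%:C <= state_of (rho L) (O1 L ^+ 2))
    (M : nat) :
  (\forall L \near \oo, forall k : int, (`|k| <= M)%N ->
     Znorm (rho L) (O1 L) (O2 L) k != 0) /\
  asymptotically_reversible (fun L => liouvillian (H L) (Ls L))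
    (fun L => omegaM (rho L) (O1 L) (O2 L) M) /\
  metastable (fun L => liouvillian (H L) (Ls L))
    (fun L => omegaM (rho L) (O1 L) (O2 L) M).
Proof.
have [r gens_supp] := hloc; have [b b_gt0 term_bound] := hbd.
have [O1loc [r1 [O1_sum O1loc_supp]]] := hO1.
have [O2loc [r2 [O2_sum O2loc_supp]]] := hO2.
have /andP[mu_gt0 _] := hmu.
split; last split.
- exact: (@Znorm_neq0 _ _ _ hd _ _ _ _ _ r _ _ _ _ hrho hO1sa hO2sa ho
    mu_gt0 O1_sum O2_sum O1loc_supp O2loc_supp hO12 hLRO M).
- exact: (omegaM_asymptotically_reversible hd hH gens_supp b_gt0 term_bound hrho hrev
    hO1sa hO2sa ho mu_gt0 O1_sum O2_sum O1loc_supp O2loc_supp hO12 hLRO M).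
- exact: (omegaM_metastable hd hH gens_supp b_gt0 term_bound hrho hrev
    hO1sa hO2sa ho mu_gt0 O1_sum O2_sum O1loc_supp O2loc_supp hO12 hLRO M).
Qed.
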